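(* Let $\mathfrak g$ be a complex simple Lie algebra. For a number $d$ let $\mathcal R_d=\{\gamma\in\Delta^+\setminus\mathcal K\mid\gamma(x_{\mathcal K})=d\}$ and $m_d=\#\mathcal R_d$. Then for any $d$ there is a natural bijection between the sets $\mathcal R_d$ and $\mathcal R_{1-d}$. In particular, $m_d=m_{1-d}$, i.e., the multiset of values $\{\gamma(x_{\mathcal K})\mid\gamma\in\Delta^+\setminus\mathcal K\}$ (each value $d$ taken with multiplicity $m_d$) is symmetric with respect to $1/2$.
   Context: Let $\mathfrak g$ be a complex simple Lie algebra, $\mathfrak t$ a Cartan subalgebra, $\Delta$ the root system of $(\mathfrak g,\mathfrak t)$, $\Delta^+$ a fixed set of positive roots, $\theta$ the highest root. Let $(\ ,\ )$ be the positive-definite form on the $\mathbb Q$-span of $\Delta$ induced by the Killing form; it is used to identify $\mathfrak t$ and $\mathfrak t^*$. For $\gamma\in\Delta$ put $\gamma^\vee=2\gamma/(\gamma,\gamma)$. Kostant cascade $\mathcal K=\{\beta_1,\dots,\beta_m\}\subset\Delta^+$: it is defined recursively. Its first element is $\beta_1=\theta$. The root system $\Delta_\theta=\{\gamma\in\Delta\mid(\gamma,\theta)=0\}$ is decomposed into irreducible components, each with the set of positive roots inherited from $\Delta^+$; the highest roots of these components are added to $\mathcal K$, and the procedure is repeated for each component until it terminates. The roots in $\mathcal K$ are pairwise strongly orthogonal. The cascade element is $x_{\mathcal K}=\frac12\sum_{i=1}^m\beta_i^\vee\in\mathfrak t$, i.e., the unique element of the $\mathbb Q$-span of $\mathcal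 K$ with $\beta_i(x_{\mathcal K})=1$ for all $i$. *)

(* Defs.v *)
From HB Require Import structures.
From mathcomp Require Import all_boot all_order all_algebra.
From mathcomp Require Import finmap.
From mathcomp Require Import boolp classical_sets functions cardinality fsbigop.
From mathcomp Require Import reals complex.

Set Implicit Arguments.
Unset Strict Implicit.
Unset Printing Implicit Defensive.

Import GRing.Theory.
Local Open Scope classical_set_scope.
Local Open Scope ring_scope.

HB.mixin Record Vector_isLieAlgebra (F : fieldType) L of Vector F L := {
  lie : L -> L -> L;
  lie_linearl : forall y, linear (fun x => lie x y);
  lie_linearr : forall x, linear (lie x);
  liexx : forall x, lie x x = 0;
  lie_jacobi : forall x y z,
    lie x (lie y z) + lie y (lie z x) + lie z (lie x y) = 0
}.

#[short(type="lieAlgType")]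
HB.structure Definition LieAlgebra (F : fieldType) :=
  {L of Vector F L & Vector_isLieAlgebra F L}.

Section LieAlgebras.
Variables (F : fieldType) (g : lieAlgType F).
Implicit Types (x y : g) (U : {vspace g}).

HB.instance Definition _ x :=
  GRing.isSemilinear.Build F g g *:%R (lie x)
    (GRing.semilinear_linear (lie_linearr x)).

Definition ad x : 'End(g) := linfun (lie x).

Lemma adE x y : ad x y = lie x y.
Proof. exact: lfunE. Qed.

Lemma ad_linear : linear ad.
Proof.
by move=> a x y; apply/lfunP => z;
  rewrite add_lfunE scale_lfunE !adE (lie_linearl z).
Qed.

Definition lfun_mx (f : 'End(g)) : 'M[F]_(\dim {:g}) :=
  passmx.mxof (vbasis {:g}) (vbasis {:g}) f.

Definition killing x y : F := \tr (lfun_mx (ad x \o ad y)%VF).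

Lemma killing_linearr x : linear (killing x : g -> F^o).
Proof.
move=> a y z; rewrite /killing ad_linear comp_lfunDr -comp_lfunZr.
by rewrite /lfun_mx passmx.mxof_linear mxtraceD mxtraceZ.
Qed.

Lemma killing_linearl y : linear (killing^~ y : g -> F^o).
Proof.
move=> a x z; rewrite /killing ad_linear comp_lfunDl -comp_lfunZl.
by rewrite /lfun_mx passmx.mxof_linear mxtraceD mxtraceZ.
Qed.

Definition lie_ideal U : Prop := forall x y, y \in U -> lie x y \in U.

Definition lie_abelian U : Prop := {in U &, forall x y, lie x y = 0}.

Definition lie_simple : Prop :=
  ~ lie_abelian fullv /\
  (forall U, lie_ideal U -> U = 0%VS \/ U = fullv).

(* A maximal abelian subalgebra consisting of ad-semisimple elements; over an
   algebraically closed field, semisimple endomorphisms are the diagonalizable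
   ones. *)
Definition cartan_subalgebra U : Prop :=
  [/\ lie_abelian U,
      (forall U', lie_abelian U' -> (U <= U')%VS -> U' = U) &
      (forall x, x \in U -> diagonalizable (lfun_mx (ad x)))].

End LieAlgebras.

Section Roots.
Variables (F : fieldType) (g : lieAlgType F) (t : {vspace g}).

Definition dual := 'Hom(subvs_of t, F^o).
Implicit Types (a b c : dual) (h : subvs_of t) (P Phi Psi : set dual).

Definition in_root_space a (x : g) : Prop :=
  forall h, lie (vsval h) x = (a h : F) *: x.

Definition roots : set dual :=
  [set a | a != 0 /\ exists2 x : g, x != 0 & in_root_space a x].

Definition killing_on h : subvs_of t -> F^o :=
  fun h' => killing (vsval h) (vsval h').

Lemma killing_on_linear h : linear (killing_on h).
Proof. by move=> k x y; rewrite /killing_on linearP killing_linearr. Qed.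

HB.instance Definition _ h :=
  GRing.isSemilinear.Build F (subvs_of t) F^o *:%R (killing_on h)
    (GRing.semilinear_linear (killing_on_linear h)).

Definition flat_fun h : dual := linfun (killing_on h).

Lemma flat_fun_linear : linear flat_fun.
Proof.
move=> k x y; apply/lfunP => z; rewrite add_lfunE scale_lfunE !lfunE /=.
by rewrite /killing_on linearP killing_linearl.
Qed.

HB.instance Definition _ :=
  GRing.isSemilinear.Build F (subvs_of t) dual *:%R flat_fun
    (GRing.semilinear_linear flat_fun_linear).

Definition flat : 'Hom(subvs_of t, dual) := linfun flat_fun.

Lemma flatE h h' : flat h h' = killing (vsval h) (vsval h').
Proof. by rewrite !lfunE. Qed.

(* [flat] is invertible when g is simple and t is a Cartan subalgebra, since
   the Killing form is then nondegenerate on t; [sharp] is its inverse. *)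
Definition sharp a : subvs_of t := (flat^-1)%VF a.

Definition form a b : F := killing (vsval (sharp a)) (vsval (sharp b)).

(* The coroot 2a/(a,a), carried from the dual of t to t by the form. *)
Definition coroot a : subvs_of t := (2 / form a a) *: sharp a.

Definition positive_system P : Prop :=
  [/\ P `<=` roots,
      (forall a, roots a -> P a \/ P (- a)),
      (forall a, P a -> ~ P (- a)) &
      (forall a b, P a -> P b -> roots (a + b) -> P (a + b))].

Definition irreducible_roots Phi : Prop :=
  Phi !=set0 /\
  forall A B, A `|` B = Phi -> A `&` B = set0 ->
    (forall a b, A a -> B b -> form a b = 0) -> A = set0 \/ B = set0.

Definition irreducible_component Phi Psi : Prop :=
  [/\ Psi `<=` Phi, irreducible_roots Psi &
      forall a b, Psi a -> (Phi `\` Psi) b -> form a b = 0].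

Definition orthogonal_roots Phi b : set dual :=
  [set c | Phi c /\ form c b = 0].

Section Cascade.
Variable P : set dual.

(* The greatest element of Phi for the order in which c <= b when b - c is a
   sum, with natural coefficients, of roots in Phi `&` P. *)
Definition highest_root Phi b : Prop :=
  Phi b /\
  forall c, Phi c -> exists n : dual -> nat,
    b - c = \sum_(a \in Phi `&` P) a *+ n a.

Inductive cascade_from : set dual -> dual -> Prop :=
| cascade_top Phi b : highest_root Phi b -> cascade_from Phi b
| cascade_next Phi b Psi c :
    highest_root Phi b ->
    irreducible_component (orthogonal_roots Phi b) Psi ->
    cascade_from Psi c ->
    cascade_from Phi c.

Definition kostant_cascade : set dual := [set b | cascade_from roots b].

Definition cascade_element : subvs_of t :=
  2^-1 *: \sum_(b \in kostant_cascade) coroot b.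

Definition level_set (d : F) : set dual :=
  [set c | (P `\` kostant_cascade) c /\ c cascade_element = d].

Definition level_mult (d : F) : nat := #|` fset_set (level_set d)|.

End Cascade.
End Roots.

(* Main.v *)
Require Import Defs.
From HB Require Import structures.
From mathcomp Require Import all_boot all_order all_algebra.
From mathcomp Require Import finmap.
From mathcomp Require Import boolp classical_sets functions cardinality fsbigop.
From mathcomp Require Import reals complex.
From mathcomp Require Import ring.

Set Implicit Arguments.
Unset Strict Implicit.
Unset Printing Implicit Defensive.

Import Order.TTheory GRing.Theory Num.Theory passmx.
Local Open Scope classical_set_scope.
Local Open Scope ring_scope.

(** For a root [c] that is positive and outside the cascade there is exactly one
    element [b] of the cascade such that [b - c] is positive; then [b - c] is
    outside the cascade too, so [c |-> b - c] is an involution [phi] of the set of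
    such roots. As [b] takes the value 1 on the cascade element, [phi] exchanges
    the levels [d] and [1 - d].

    The root [b] is found by descending the tree that defines the cascade. At a
    node [Phi] with greatest root [th], a positive [c] orthogonal to [th] is handed
    down to its irreducible component. Otherwise [c <> th] and the [th]-string
    through [c] begins at [c], so it reaches [c - N th] with
    [N = 2 (c, th) / (th, th) > 0]; if [N >= 2], then [c - 2 th] or 0 is in [Phi],
    and [2 th - c] or [c = 2 th] would exceed [th]. So [N = 1] ([top_half]) and
    [th - c] is a positive root ([cascade_exists]). Uniqueness comes from
    dominance, [(th, a) >= 0] for all positive [a] in [Phi] ([cascade_unique]).
    That elements of the cascade are orthogonal to each other
    ([cascade_orthogonal]) gives both that [b - c], not orthogonal to [b], is
    outside the cascade, and that [b] takes the value 1.

    That irreducible subsystems have a greatest root is proved with no simple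
    roots ([irreducible_has_top]): different maximal roots are orthogonal and have
    no common lower bound ([no_common_lower_bound]), so the positive roots fall
    into mutually orthogonal classes, one below each maximal root.

    All this rests on few facts about the roots of [g], collected in
    [root_geometry]. They are derived from a basis of [g] in which [ad h] is
    diagonal for all [h] in [t]: there the Killing form on [t] is the sum over the
    basis of the products of weights, and traces over a string of weights can be
    computed entrywise. Those traces vanish on brackets [[e, f]] of opposite root
    vectors ([string_trace]), so that every weight is a rational multiple of one of
    them there; this yields the nondegeneracy of the Killing form
    ([killing_nondegenerate]) and [(a, a) != 0] for roots [a]. The sl2-triple of
    [a] then gives the strings, the integrality of the Cartan numbers, and with it
    [(a, a) > 0]. Irreducibility of the whole root system is the simplicity of [g]
    ([simple_roots_irreducible]). *)

(** * Lie brackets *)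

Section LieBasics.
Variables (F : fieldType) (g : lieAlgType F).
Implicit Types x y z : g.

Lemma lieDl x y z : lie (x + y) z = lie x z + lie y z.
Proof. by have := lie_linearl z 1 x y; rewrite !scale1r. Qed.

Lemma lie0l z : lie 0 z = 0 :> g.
Proof. by apply: (addIr (lie 0 z)); rewrite -lieDl !add0r. Qed.

Lemma lieZl k x z : lie (k *: x) z = k *: lie x z.
Proof. by have := lie_linearl z k x 0; rewrite !addr0 lie0l addr0. Qed.

Lemma lieC x y : lie x y = - lie y x.
Proof.
apply/eqP; rewrite -addr_eq0; have := liexx (x + y).
by rewrite lieDl !linearD /= !liexx add0r addr0 => ->.
Qed.

Lemma lieNl x z : lie (- x) z = - lie x z.
Proof. by rewrite -scaleN1r lieZl scaleN1r. Qed.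

Lemma lie_suml (I : Type) (r : seq I) (p : pred I) (f : I -> g) z :
  lie (\sum_(i <- r | p i) f i) z = \sum_(i <- r | p i) lie (f i) z.
Proof. by rewrite lieC linear_sum -sumrN; apply: eq_bigr => i _; rewrite -lieC. Qed.

(** The Jacobi identity in the form in which it is applied: [lie x] is a
    derivation. *)
Lemma lie_derivation x y z : lie x (lie y z) = lie (lie x y) z + lie y (lie x z).
Proof.
have /eqP := lie_jacobi x y z; rewrite -addrA addr_eq0 => /eqP ->.
by rewrite opprD (lieC z (lie x y)) opprK addrC (lieC z x) linearN opprK.
Qed.

(** The computation behind the representations of sl2: for a highest weight
    vector [x] of weight [m], in characteristic zero, [f^(k+1) x = 0] forces [m = k]
    or [f^k x = 0]. *)
Lemma sl2_raise_lower e f h x (m : F) k :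
  lie e f = h -> lie h f = - 2 *: f -> lie h x = m *: x -> lie e x = 0 ->
  lie e (iter k.+1 (lie f) x) = (k.+1%:R * (m - k%:R)) *: iter k (lie f) x.
Proof.
move=> ef hf hx ex.
have hfk j : lie h (iter j (lie f) x) = (m - 2 * j%:R) *: iter j (lie f) x.
  elim: j => [|j IH]; first by rewrite mulr0 subr0.
  rewrite iterS lie_derivation hf IH lieZl linearZ -scalerDl /=; congr (_ *: _).
  ring.
elim: k => [|k IH]; first by rewrite iterS /= lie_derivation ef ex linear0 addr0 subr0 mul1r.
rewrite iterS lie_derivation ef IH hfk linearZ -scalerDl /=; congr (_ *: _).
ring.
Qed.

End LieBasics.

(** * A basis of weight vectors *)

Section WeightBasis.
Variables (F : fieldType) (g : lieAlgType F) (t : {vspace g}).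
Implicit Types x y z : g.
Local Notation n := (\dim {:g}).
Local Notation X := (vbasis {:g}).

Lemma lfun_mx_linear : linear (@lfun_mx F g).
Proof. by move=> k x y; rewrite /lfun_mx mxof_linear. Qed.

Lemma lfun_mx_comp (p q : 'End(g)) : lfun_mx (p \o q)%VF = lfun_mx q *m lfun_mx p.
Proof. exact: (mxof_comp _ _ (vbasisP {:g})). Qed.

Variable Q : 'M[F]_n.

(** The matrix of [ad x], on row vectors, in the basis of [g] given by the rows of
    [Q]. It is locked because the rules for matrix products and entries would
    otherwise apply to its three factors. *)
Definition ad_mx (x : g) : 'M[F]_n := locked (Q *m lfun_mx (ad x) *m invmx Q).

Lemma ad_mx_unlock x : ad_mx x = Q *m lfun_mx (ad x) *m invmx Q.
Proof. by rewrite /ad_mx -lock. Qed.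

(** The basis given by the rows of [Q], and the coordinates of a vector in it. *)
Definition wvec (i : 'I_n) : g := vecof X (row i Q).

Definition wrow (x : g) : 'rV[F]_n := locked (rVof X x *m invmx Q).

Lemma wrow_unlock x : wrow x = rVof X x *m invmx Q.
Proof. by rewrite /wrow -lock. Qed.

Lemma ad_mx_linear : linear ad_mx.
Proof.
move=> k x y; rewrite !ad_mx_unlock ad_linear lfun_mx_linear.
by rewrite mulmxDr mulmxDl -scalemxAr -scalemxAl.
Qed.

HB.instance Definition _ := GRing.isSemilinear.Build F g 'M[F]_n *:%R ad_mx
    (GRing.semilinear_linear ad_mx_linear).

Definition wt_fun (i : 'I_n) (h : subvs_of t) : F^o := ad_mx (vsval h) i i.

Lemma wt_fun_linear i : linear (wt_fun i).
Proof. by move=> k x y; rewrite /wt_fun !linearP /= !mxE. Qed.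

HB.instance Definition _ i :=
  GRing.isSemilinear.Build F (subvs_of t) F^o *:%R (wt_fun i)
    (GRing.semilinear_linear (wt_fun_linear i)).

Definition wt i : dual t := linfun (wt_fun i).

Lemma wrow_linear : linear wrow.
Proof. by move=> k x y; rewrite !wrow_unlock linearP mulmxDl -scalemxAl. Qed.

HB.instance Definition _ := GRing.isSemilinear.Build F g 'rV[F]_n *:%R wrow
    (GRing.semilinear_linear wrow_linear).

Definition wcoord_fun i x : F^o := wrow x 0 i.

Lemma wcoord_fun_linear i : linear (wcoord_fun i).
Proof. by move=> k x y; rewrite /wcoord_fun linearP !mxE. Qed.

HB.instance Definition _ i :=
  GRing.isSemilinear.Build F g F^o *:%R (wcoord_fun i)
    (GRing.semilinear_linear (wcoord_fun_linear i)).

Definition wcoord i : 'Hom(g, F^o) := linfun (wcoord_fun i).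

Lemma wcoordE i x : wcoord i x = wrow x 0 i.
Proof. by rewrite lfunE. Qed.

Hypothesis Qu : Q \in unitmx.

Lemma wrow_wvec i : wrow (wvec i) = delta_mx 0 i.
Proof.
rewrite wrow_unlock /wvec vecofK ?vbasisP // -row_mul mulmxV //.
by rewrite rowE mulmx1.
Qed.

Lemma wrowE x : x = \sum_i wrow x 0 i *: wvec i.
Proof.
rewrite -[LHS](rVofK (vbasisP {:g})) -[rVof _ x](mulmxKV Qu).
rewrite -wrow_unlock mulmx_sum_row linear_sum; apply: eq_bigr => i _.
by rewrite linearZ.
Qed.

Lemma wrow_inj x : wrow x = 0 -> x = 0.
Proof. by move=> x0; rewrite [x]wrowE big1 // => i _; rewrite x0 mxE scale0r. Qed.

Lemma wrow_lie x y : wrow (lie x y) = wrow y *m ad_mx x.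
Proof.
rewrite !wrow_unlock ad_mx_unlock !mulmxA mulmxKV // /lfun_mx mul_mxof.
by rewrite rVofK ?vbasisP // adE.
Qed.

Lemma wvec_neq0 i : wvec i != 0.
Proof.
apply/eqP => v0; have := wrow_wvec i; rewrite v0 linear0 => /matrixP/(_ 0 i)/eqP.
by rewrite !mxE !eqxx eq_sym oner_eq0.
Qed.

Lemma ad_mxE x i j : ad_mx x i j = wrow (lie x (wvec i)) 0 j.
Proof. by rewrite wrow_lie wrow_wvec -rowE mxE. Qed.

Lemma killingE x y : killing x y = \tr (ad_mx x *m ad_mx y).
Proof.
rewrite /killing lfun_mx_comp mxtrace_mulC !ad_mx_unlock !mulmxA mulmxKV //.
by rewrite [RHS]mxtrace_mulC !mulmxA mulVmx // mul1mx.
Qed.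

Lemma ad_mx_lie x y : ad_mx (lie x y) = ad_mx y *m ad_mx x - ad_mx x *m ad_mx y.
Proof.
apply/row_matrixP => i; rewrite !rowE -!wrow_wvec -wrow_lie /= mulmxBr !mulmxA.
rewrite -!wrow_lie -linearB /=; congr wrow.
by rewrite [lie x (lie y _)]lie_derivation addrK.
Qed.

Lemma killingC x y : killing x y = killing y x.
Proof. by rewrite !killingE mxtrace_mulC. Qed.

Lemma killing_lie x y z : killing (lie x y) z = killing x (lie y z).
Proof.
rewrite !killingE !ad_mx_lie mulmxBl mulmxBr !linearB /= !mulmxA.
rewrite -(mulmxA (ad_mx y)) mxtrace_mulC -mulmxA.
by rewrite [X in _ - X](mxtrace_mulC) !mulmxA [X in _ - X](mxtrace_mulC) mulmxA.
Qed.

HB.instance Definition _ x := GRing.isSemilinear.Build F g F^o *:%R (killing x)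
    (GRing.semilinear_linear (killing_linearr x)).

Lemma killingZr k x y : killing x (k *: y) = k * killing x y.
Proof. exact: linearZ. Qed.

Lemma killingZl k x y : killing (k *: x) y = k * killing x y.
Proof. by rewrite killingC killingZr killingC. Qed.

Lemma killingNl x y : killing (- x) y = - killing x y.
Proof. by rewrite -scaleN1r killingZl mulN1r. Qed.

Lemma killing_suml (I : Type) (r : seq I) (p : pred I) (f : I -> g) z :
  killing (\sum_(i <- r | p i) f i) z = \sum_(i <- r | p i) killing (f i) z.
Proof.
rewrite killingC (linear_sum (killing z)); apply: eq_bigr => i _.
exact: killingC.
Qed.

Hypothesis Qd : forall h, h \in t -> is_diag_mx (ad_mx h).

Lemma wvec_in_root_space i : in_root_space (wt i) (wvec i).
Proof.
move=> h; rewrite [LHS]wrowE (bigD1 i) //= -ad_mxE big1 ?addr0 ?lfunE // => j ji.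
have /is_diag_mxP/(_ i j) := Qd (subvsP h); rewrite ad_mxE => ->; rewrite ?scale0r //.
by apply: contraNneq ji => /val_inj ->.
Qed.

Lemma in_root_spaceD a b x y :
  in_root_space a x -> in_root_space b y ->
  @in_root_space _ _ t (a + b) (lie x y).
Proof.
move=> ax ay h; rewrite lie_derivation ax ay lieZl linearZ /= -scalerDl.
by rewrite add_lfunE.
Qed.

(** The weights of the basis are the only ones of [g]: the coordinates of a vector
    of weight [a] are supported where the weight is [a]. *)
Lemma in_root_space_wt a x i :
  @in_root_space _ _ t a x -> wrow x 0 i != 0 -> wt i = a.
Proof.
move=> ax xi; apply/lfunP => h; apply: (mulfI xi).
have := congr1 (fun z => wrow z 0 i) (ax h); rewrite linearZ /= !mxE.
rewrite mulrC => <-; rewrite wrow_lie mxE (bigD1 i) //= big1 ?addr0 ?lfunE //.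
by move=> j ji; have /is_diag_mxP/(_ j i) := Qd (subvsP h) => ->; rewrite ?mulr0.
Qed.

(** A vector of weight [a] moves weights by [a]. This locates the entries of
    [ad_mx x] that can be nonzero. *)
Lemma ad_mx_wt a x i j :
  @in_root_space _ _ t a x -> ad_mx x i j != 0 -> wt j = a + wt i.
Proof.
move=> ax; rewrite ad_mxE; apply: in_root_space_wt.
exact: in_root_spaceD ax (wvec_in_root_space i).
Qed.

Lemma ad_mx_diag (h : subvs_of t) i j :
  ad_mx (vsval h) i j = if i == j then wt i h else 0.
Proof.
case: eqP => [->|/eqP ij]; first by rewrite lfunE.
have /is_diag_mxP/(_ i j) := Qd (subvsP h) => -> //.
Qed.

Lemma killing_wt (h h' : subvs_of t) :
  killing (vsval h) (vsval h') = \sum_i wt i h * wt i h'.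
Proof.
rewrite killingE /mxtrace; apply: eq_bigr => i _.
rewrite mxE (bigD1 i) //= !ad_mx_diag eqxx big1 ?addr0 // => j ji.
by rewrite ad_mx_diag eq_sym (negPf ji) mul0r.
Qed.

End WeightBasis.

(** The operators [ad h] commute because [t] is abelian, so that they can be
    diagonalized together. *)
Lemma cartan_diagonal_basis (F : fieldType) (g : lieAlgType F) (t : {vspace g}) :
  cartan_subalgebra t ->
  exists2 Q, Q \in unitmx & forall h, h \in t -> is_diag_mx (ad_mx Q h).
Proof.
case=> abt _ dt; pose As := [seq lfun_mx (ad h) | h <- vbasis t].
have /codiagonalizableP [Q Qu /allP QA] :
    {in As &, forall A B, comm_mx A B} /\ {in As, forall A, diagonalizable A}.
  split=> [_ _ /mapP[x /vbasis_mem xt ->] /mapP[y /vbasis_mem yt ->]|].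
    rewrite /comm_mx -!lfun_mx_comp; congr lfun_mx; apply/lfunP => z.
    by rewrite !comp_lfunE !adE lie_derivation (abt y x) // lie0l add0r.
  by move=> _ /mapP[x /vbasis_mem xt ->]; apply: dt.
exists Q => // h ht; apply/is_diag_mxP => i j ij.
rewrite (coord_vbasis ht) linear_sum summxE big1 // => k _.
rewrite linearZ mxE; have /QA/= : lfun_mx (ad (vbasis t)`_k) \in As.
  by apply/map_f/mem_nth; rewrite size_tuple.
by move/(diagonalizable_forP _ Qu) => /(_ i j ij); rewrite -ad_mx_unlock => ->; rewrite mulr0.
Qed.

(** * Simple Lie algebras *)

Section SimpleAlgebra.
Variables (F : fieldType) (g : lieAlgType F).
Hypothesis simple_g : lie_simple g.
Implicit Types x y z : g.

(** The form in which simplicity is used: ideals arise below as common kernels of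
    finitely many linear maps, the [f i] such that [p i]. *)
Lemma simple_dichotomy (W : vectType F) (I : finType) (p : I -> Prop)
    (f : I -> 'Hom(g, W)) :
  (forall x y, (forall i, p i -> f i y = 0) ->
     forall i, p i -> f i (lie x y) = 0) ->
  (forall x, (forall i, p i -> f i x = 0) -> x = 0) \/
  (forall x i, p i -> f i x = 0).
Proof.
move=> idealf; pose U := (\bigcap_(i | `[< p i >]) lker (f i))%VS.
have UP x : reflect (forall i, p i -> f i x = 0) (x \in U).
  rewrite memvE; apply: (iffP subv_bigcapP) => xU i pi.
    by apply/eqP; rewrite -memv_ker memvE xU //; apply/asboolP.
  by rewrite -memvE memv_ker; apply/eqP/xU/asboolP.
case: simple_g => _ /(_ U) [x y /UP yU|U0|U1].
- by apply/UP; apply: idealf.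
- by left=> x /UP; rewrite U0 memv0 => /eqP.
- by right=> x; apply/UP; rewrite U1 memvf.
Qed.

Lemma simple_nonabelian : ~ (forall x y, lie x y = 0).
Proof. by move=> ab; case: simple_g => + _; apply=> x y _ _; apply: ab. Qed.

HB.instance Definition _ := GRing.isSemilinear.Build F g 'End(g) *:%R (@ad F g)
    (GRing.semilinear_linear (@ad_linear F g)).

Lemma simple_center x : (forall y, lie x y = 0) -> x = 0.
Proof.
move=> xc.
have [||ab] := @simple_dichotomy 'End(g) _ (fun _ : unit => True)
                   (fun _ => linfun (@ad F g)).
- move=> y z /(_ tt I) zc _ _; rewrite lfunE in zc; rewrite lfunE /=.
  have -> : lie y z = 0 by rewrite lieC -(adE z) zc lfunE oppr0.
  by rewrite linear0.
- move=> H; apply: H => _ _; rewrite lfunE; apply/lfunP => y; rewrite adE xc lfunE //.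
case: simple_nonabelian => y z.
by have /lfunP/(_ z) := ab y tt I; rewrite lfunE adE lfunE.
Qed.

End SimpleAlgebra.

(** * Root spaces and the Killing form *)

Section RootSpaces.
Variables (F : numFieldType) (g : lieAlgType F) (t : {vspace g}).
Variable Q : 'M[F]_(\dim {:g}).
Hypothesis Qu : Q \in unitmx.
Hypothesis Qd : forall h, h \in t -> is_diag_mx (ad_mx Q h).
Hypothesis cartan_t : cartan_subalgebra t.
Hypothesis simple_g : lie_simple g.
Implicit Types (x y z : g) (a b c : dual t) (h : subvs_of t).
Local Notation w := (wt t Q).
Local Notation v := (wvec Q).
Local Notation roots := (@Defs.roots _ _ t).
Local Notation form := (@Defs.form _ _ t).

Definition weight a := exists i, w i = a.

Lemma root_space_weight a x : in_root_space a x -> x != 0 -> weight a.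
Proof.
move=> ax x0; have [i xi] : exists i, wrow Q x 0 i != 0.
  apply/existsP; apply: contraNT x0 => /existsPn x0; apply/eqP.
  by apply: (wrow_inj Qu); apply/rowP => i; rewrite mxE; apply/eqP; rewrite -[_ == _]negbK x0.
by exists i; apply: (in_root_space_wt Qu Qd ax).
Qed.

Lemma weight_root_space a : weight a -> exists2 x, x != 0 & in_root_space a x.
Proof.
by case=> i <-; exists (v i); [apply: wvec_neq0|apply: wvec_in_root_space].
Qed.

Lemma rootsE a : roots a <-> a != 0 /\ weight a.
Proof.
split=> -[a0].
  by case=> x x0 ax; split=> //; apply: root_space_weight ax x0.
by move/weight_root_space => [x x0 ax]; split=> //; exists x.
Qed.

Lemma root_space_eq0 a x : ~ weight a -> in_root_space a x -> x = 0.
Proof. by move=> aw ax; apply/eqP/negP => /negP x0; apply: aw; apply: root_space_weight ax x0. Qed.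

(** [t] is its own centralizer: [t] and [x] span an abelian subalgebra, and [t] is
    maximal. *)
Lemma root_space0 x : in_root_space (0 : dual t) x -> x \in t.
Proof.
case: cartan_t => abt maxt _ x0; rewrite -(maxt (t + <[x]>)%VS).
- by rewrite memvE addvSr.
- have tx y : y \in t -> lie y x = 0.
    by move=> yt; have := x0 (vsproj t y); rewrite vsprojK // lfunE scale0r.
  move=> y1 z1 /memv_addP[y yt [_ /vlineP[k ->] ->]].
  move=> /memv_addP[z zt [_ /vlineP[l ->] ->]].
  rewrite !lieDl !linearD /= !lieZl !linearZ /= (abt y z) // (tx y) //.
  by rewrite (lieC x z) (tx z) // liexx !scaler0 oppr0 !scaler0 !addr0.
- exact: addvSl.
Qed.

Lemma lie_opposite a x y : in_root_space a x -> in_root_space (- a) y ->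
  exists h, vsval h = lie x y.
Proof.
move=> ax ay; exists (vsproj t (lie x y)); apply: vsprojK.
by apply: root_space0; rewrite -(subrr a); apply: in_root_spaceD.
Qed.

Lemma weights_separate h : (forall i, w i h = 0) -> h = 0.
Proof.
move=> wh; apply/val_inj/(simple_center simple_g) => y.
rewrite [y](wrowE Qu) linear_sum big1 // => i _.
by rewrite linearZ /= (wvec_in_root_space Qu Qd) wh scale0r scaler0.
Qed.

Section StringTrace.
Variables (a : dual t) (e f : g) (h : subvs_of t).
Hypotheses (ae : in_root_space a e) (af : in_root_space (- a) f).
Hypothesis hE : vsval h = lie e f.

(** On the span of the weight vectors with weight in [b + Z a], which [ad e] and
    [ad f] preserve, [ad h] is a commutator and so has trace zero. *)
Lemma string_trace b :
  let S := [pred i | `[< exists k : int, w i = b + k%:~R *: a >]] in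
  \sum_(i in S) w i h = 0.
Proof.
move=> S.
have Sstep (E : g) (l : int) i j : in_root_space (l%:~R *: a) E ->
    ad_mx Q E i j != 0 -> (j \in S) = (i \in S).
  move=> lE Eij; have wj := ad_mx_wt Qu Qd lE Eij; rewrite !inE.
  apply/asboolP/asboolP => -[k kE].
    exists (k - l); move: wj; rewrite kE intrB scalerBl => wj.
    by apply: (addrI (l%:~R *: a)); rewrite -wj addrCA subrKC addrC.
  by exists (l + k); rewrite wj kE intrD scalerDl addrCA.
have eS i j : ad_mx Q e i j != 0 -> (j \in S) = (i \in S).
  by apply: (Sstep _ 1); rewrite scale1r.
have fS i j : ad_mx Q f i j != 0 -> (j \in S) = (i \in S).
  by apply: (Sstep _ (- 1)); rewrite scaleN1r.
have -> : \sum_(i in S) w i h = \sum_(i in S) (ad_mx Q (lie e f)) i i.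
  by apply: eq_bigr => i _; rewrite -hE (ad_mx_diag Qd) eqxx.
have restrict (A B : 'M[F]_(\dim {:g})) :
    (forall i j, A i j != 0 -> (j \in S) = (i \in S)) ->
    \sum_(i in S) (A *m B) i i = \sum_(i in S) \sum_(j in S) A i j * B j i.
  move=> AS; apply: eq_bigr => i iS; rewrite mxE (bigID (mem S)) /=.
  rewrite [X in _ + X]big1 ?addr0 // => j jS.
  have [->|/AS] := eqVneq (A i j) 0; first by rewrite mul0r.
  by rewrite iS; move: jS => /negPf; rewrite inE => ->.
under eq_bigr do rewrite (ad_mx_lie Qu) mxE [X in _ + X]mxE.
rewrite sumrB !restrict // exchange_big /=; apply/eqP; rewrite subr_eq0; apply/eqP.
by apply: eq_bigr => i _; apply: eq_bigr => j _; rewrite mulrC.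
Qed.

(** On the bracket [h], all weights are rational multiples of [a]: add up the
    values [w i h + k * a h] along the string through [w i]. *)
Lemma weight_multiple i :
  exists m : nat, exists k : int, (w i h : F) * m.+1%:R = k%:~R * a h.
Proof.
have := string_trace (w i); set S := [pred j | _] => trS.
have /choice[k kE] j : exists k : int, j \in S -> w j = w i + k%:~R *: a.
  have [|_] := boolP (j \in S); last by exists 0.
  by rewrite inE => -[k ->]; exists k.
have iS : i \in S by rewrite inE; exists 0; rewrite scale0r addr0.
exists #|S|.-1; exists (- \sum_(j in S) k j); rewrite prednK; last by apply/card_gt0P; exists i.
apply/eqP; rewrite mulr_natr rmorphN rmorph_sum /= mulNr mulr_suml -addr_eq0 -sumr_const.
rewrite -big_split /= -[X in _ == X]trS; apply/eqP/eq_bigr => j jS.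
by rewrite (kE j jS) add_lfunE scale_lfunE.
Qed.

Lemma weight_ratio_real i : a h != 0 :> F -> w i h / a h \is Num.real.
Proof.
move=> ah; have [m [k mk]] := weight_multiple i.
have -> : w i h / a h = k%:~R / m.+1%:R :> F.
  by apply/eqP; rewrite eqr_div ?pnatr_eq0 // mk.
by rewrite realM ?realV ?realn ?realz.
Qed.

Lemma weights_vanish i : a h = 0 :> F -> w i h = 0 :> F.
Proof.
move=> ah; have [m [k /eqP]] := weight_multiple i.
by rewrite ah mulr0 mulf_eq0 pnatr_eq0 orbF => /eqP.
Qed.

(** [killing h h] is the sum of the squares of the [w i h], which are real multiples
    of [a h], one of them being [a h] itself. *)
Lemma string_isotropic : killing (vsval h) (vsval h) = 0 -> weight a -> h = 0.
Proof.
rewrite (killing_wt Qu Qd) => kh [i0 wi0].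
have ah : a h = 0 :> F.
  apply/eqP/negP => /negP ah.
  have : \sum_i (w i h / a h) ^+ 2 = 0 :> F.
    under eq_bigr do rewrite expr_div_n expr2.
    by rewrite -mulr_suml kh mul0r.
  move/eqP; rewrite psumr_eq0 => [/allP/(_ i0)|i _]; last first.
    by rewrite real_exprn_even_ge0 ?weight_ratio_real.
  by rewrite mem_index_enum wi0 divff // expr1n oner_eq0 => /(_ isT).
by apply: weights_separate => i; apply: weights_vanish.
Qed.

End StringTrace.

(** Invariance gives [(a + b)(h) * killing x y = 0] for all [h]. *)
Lemma killing_root_spaces a b x y : in_root_space a x -> in_root_space b y ->
  a + b != 0 -> killing x y = 0.
Proof.
move=> ax ay ab0; apply/eqP; apply: contraNT ab0 => k0; apply/eqP/lfunP => h.
apply: (mulIf k0); rewrite !lfunE mul0r /= mulrDl.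
rewrite -(killingZl Qu (a h)) -(killingZr (b h)) -ax -ay -(killing_lie Qu).
by rewrite (lieC x) (killingNl Qu) subrr.
Qed.

Lemma opposite_bracket_eq0 x y : (forall u u' : g, killing u u' = 0) -> forall a,
  in_root_space a x -> in_root_space (- a) y -> lie x y = 0.
Proof.
move=> k0 a ax ay; have [->|x0] := eqVneq x 0; first by rewrite lie0l.
have [h hE] := lie_opposite ax ay.
by rewrite -hE (string_isotropic ax ay hE) ?k0 //; apply: root_space_weight ax x0.
Qed.

(** The radical of the form is an ideal. Were it all of [g], brackets of opposite
    root vectors would be zero, so the vectors without component of weight zero
    would form an ideal. If that is 0 then all weights are zero; if it is [g] then
    [t] is 0. In both cases [t] is centralized by [g], so it is [g], which is not
    abelian. *)
Lemma killing_nondegenerate x : (forall y, killing x y = 0) -> x = 0.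
Proof.
have [] := @simple_dichotomy _ _ simple_g F^o _ (fun _ => True)
                   (fun i => linfun (killing (v i) : g -> F^o)).
- move=> y z zr i _; rewrite lfunE /= -(killing_lie Qu) (killingC Qu).
  rewrite [lie _ _](wrowE Qu) (linear_sum (killing z)) big1 // => j _.
  by rewrite linearZ /= (killingC Qu); have := zr j I; rewrite lfunE /= => ->; rewrite scaler0.
- by move=> rad0 kx; apply: rad0 => i _; rewrite lfunE /= (killingC Qu).
move=> radT _; have k0 (y z : g) : killing y z = 0.
  rewrite [y](wrowE Qu) (killing_suml Qu) big1 // => i _.
  by rewrite (killingZl Qu); have := radT z i I; rewrite lfunE /= => ->; rewrite mulr0.
have wvE i := (wvec_in_root_space Qu Qd i).
suff tT y : y \in t.
  case: (simple_nonabelian simple_g) => y z; case: cartan_t => abt _ _.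
  exact: abt.
have wvec_t i : w i = 0 -> v i \in t.
  by move=> wi; apply: root_space0; rewrite -wi.
have v_t : (forall i, w i = 0) -> y \in t.
  by move=> w0; rewrite [y](wrowE Qu) memv_suml // => i _; rewrite memvZ ?wvec_t.
have vcoord i j : wcoord Q i (v j) = (i == j)%:R by rewrite wcoordE (wrow_wvec Qu) mxE.
have [|coord0|coordT] := @simple_dichotomy _ _ simple_g F^o _ (fun i => w i = 0)
  (wcoord Q).
- move=> p q q0 i wi; rewrite [p](wrowE Qu) [q](wrowE Qu) lie_suml.
  rewrite linear_sum big1 // => j _; rewrite lieZl linear_sum scaler_sumr linear_sum.
  rewrite big1 // => k _; rewrite !linearZ /=.
  have [->|qk] := eqVneq (wrow Q q 0 k) 0; first by rewrite scale0r scaler0.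
  have [->|jk] := eqVneq (wcoord Q i (lie (v j) (v k))) 0; first by rewrite !scaler0.
  have wjk : w j + w k = 0.
    rewrite -wi; apply/esym; move: jk; rewrite wcoordE; apply: (in_root_space_wt Qu Qd).
    by apply: in_root_spaceD; apply: wvE.
  rewrite (@opposite_bracket_eq0 _ _ k0 (w j)) ?linear0 ?scaler0 //.
  by move/eqP: wjk; rewrite addrC addr_eq0 => /eqP <-.
- apply: v_t => i; apply/eqP/negP => /negP wi.
  (* a weight vector of nonzero weight has no coordinate of weight zero *)
  case/eqP: (wvec_neq0 Qu i); apply: coord0 => j wj; rewrite vcoord.
  by have [ij|//] := eqVneq i j; rewrite ij wj eqxx in wi.
have t0 z : z \in t -> z = 0.
  move=> zt; apply: (wrow_inj Qu); apply/rowP => i; rewrite mxE.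
  apply/eqP/negP => /negP zi.
  have wi : w i = 0.
    apply: (in_root_space_wt Qu Qd _ zi) => h.
    by case: cartan_t => abt _ _; rewrite abt ?subvsP // lfunE scale0r.
  by have /eqP := coordT (v i) i wi; rewrite vcoord eqxx oner_eq0.
by apply: root_space0 => h; rewrite (t0 _ (subvsP h)) lie0l lfunE scale0r.
Qed.

Lemma in_root_spaceZ k a x : in_root_space a x -> in_root_space a (k *: x).
Proof. by move=> ax h; rewrite linearZ /= ax !scalerA mulrC. Qed.

Lemma dual_root_vector a e : in_root_space a e -> e != 0 ->
  exists2 f, in_root_space (- a) f & killing e f = 1.
Proof.
move=> ae e0; have [i ei] : exists i, killing e (v i) != 0.
  apply/existsP; apply: contraNT e0 => /existsPn e0; apply/eqP.
  apply: killing_nondegenerate => y; rewrite [y](wrowE Qu) linear_sum big1 // => i _.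
  by rewrite linearZ /=; have /negPn/eqP -> := e0 i; rewrite scaler0.
exists ((killing e (v i))^-1 *: v i); last by rewrite killingZr mulVf.
apply: in_root_spaceZ; suff <- : w i = - a by apply: wvec_in_root_space.
apply/eqP; rewrite -addr_eq0 addrC; apply: contraNT ei => wa; apply/eqP.
exact: killing_root_spaces ae (wvec_in_root_space Qu Qd i) wa.
Qed.

Lemma roots_opp a : roots a -> roots (- a).
Proof.
case=> a0 [e e0 ae]; have [f af ef] := dual_root_vector ae e0.
split; first by rewrite oppr_eq0.
by exists f => //; apply: contra_eq_neq ef => ->; rewrite linear0 eq_sym oner_eq0.
Qed.

(** The Killing form is nondegenerate on [t] too, since [t] is orthogonal to all
    vectors of nonzero weight. *)
Lemma flat_injective : lker (flat t) == 0%VS.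
Proof.
apply/lker0P => h h' /eqP; rewrite -subr_eq0 -linearB => /eqP fh.
apply/eqP; rewrite -subr_eq0; apply/eqP; move: (h - h') fh => {h'}h fh.
apply/val_inj/killing_nondegenerate => y; rewrite [y](wrowE Qu) linear_sum big1 // => i _.
rewrite linearZ /=; have [wi|wi] := eqVneq (w i) 0.
  have vt : v i \in t by apply: root_space0; rewrite -wi; apply: wvec_in_root_space.
  have /lfunP/(_ (vsproj t (v i))) := fh; rewrite flatE vsprojK // => ->.
  by rewrite lfunE scaler0.
rewrite (@killing_root_spaces 0 (w i)) ?scaler0 ?add0r //; last exact: wvec_in_root_space.
move=> h'; rewrite lfunE scale0r; case: cartan_t => abt _ _.
by rewrite abt ?subvsP.
Qed.

Lemma flat_bracket a e f h : in_root_space (- a) f -> vsval h = lie e f ->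
  flat t h = killing e f *: a.
Proof.
move=> af hE; apply/lfunP => h'; rewrite flatE hE (killing_lie Qu) lieC af.
by rewrite !lfunE /= scaleNr opprK killingZr mulrC.
Qed.

(** The bracket of [e] with a dual root vector is a preimage of [a] under [flat],
    which is injective; so it is the one that [sharp] returns. *)
Lemma sharp_bracket a e : in_root_space a e -> e != 0 ->
  exists f, [/\ in_root_space (- a) f, vsval (sharp a) = lie e f & flat t (sharp a) = a].
Proof.
move=> ae e0; have [f af ef] := dual_root_vector ae e0.
have [h hE] := lie_opposite ae af; have := flat_bracket af hE.
rewrite ef scale1r => fh; exists f.
suff -> : sharp a = h by split.
by rewrite -fh /sharp lker0_lfunK // flat_injective.
Qed.

Lemma flat_sharp a : roots a -> flat t (sharp a) = a.
Proof. by case=> _ [e e0 ae]; have [f []] := sharp_bracket ae e0. Qed.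

Lemma form_eval a b : roots a -> form a b = a (sharp b).
Proof. by move=> /flat_sharp {2}<-; rewrite flatE. Qed.

Lemma form_sym a b : form a b = form b a.
Proof. exact: (killingC Qu). Qed.

Lemma form_addl a b c : form (a + b) c = form a c + form b c.
Proof.
rewrite /Defs.form /sharp !linearD /= (killingC Qu) linearD /=.
by congr (_ + _); apply: (killingC Qu).
Qed.

Lemma form_oppl a c : form (- a) c = - form a c.
Proof. by rewrite /Defs.form /sharp !linearN /= (killingNl Qu). Qed.

Lemma form_norm_neq0 a : roots a -> form a a != 0.
Proof.
case=> a0 [e e0 ae]; have [f [af hE fh]] := sharp_bracket ae e0.
apply: contra_neq a0 => aa0; rewrite -fh (_ : sharp a = 0) ?linear0 //.
exact: string_isotropic ae af hE aa0 (root_space_weight ae e0).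
Qed.

Lemma coroot_eval a b : roots b -> b (coroot a) = 2 * form b a / form a a.
Proof. by move=> rb; rewrite /coroot linearZ /= -(form_eval a rb) mulrAC. Qed.

Lemma root_sl2 a : roots a -> exists e f,
  [/\ in_root_space a e, in_root_space (- a) f & lie e f = vsval (coroot a)].
Proof.
case=> _ [e e0 ae]; have [f [af hE _]] := sharp_bracket ae e0.
exists e, ((2 / form a a) *: f); split=> //; first exact: in_root_spaceZ.
by rewrite linearZ /= -hE /coroot.
Qed.

(** Otherwise the weights [b + k a] would be infinitely many. *)
Lemma string_finite a b : a != 0 -> exists k : nat, ~ weight (b + a *+ k).
Proof.
move=> a0; apply/not_existsP => all_w.
have /choice[i iE] k : exists i, w i = b + a *+ k by have /contrapT := all_w k.
have inj_i : injective (fun k : 'I_(\dim {:g}).+1 => i k).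
  move=> k l /(congr1 w); rewrite !iE => /addrI/eqP.
  rewrite -!scaler_nat -subr_eq0 -scalerBl scaler_eq0 (negPf a0) orbF subr_eq0.
  by rewrite eqr_nat => /eqP/val_inj.
by have := leq_card _ inj_i; rewrite !card_ord ltnn.
Qed.

(** A root vector for [b] is a highest weight vector for the sl2-triple of [a].
    Lowering it must end, at some step [N.+1] say, which by [sl2_raise_lower] forces
    its weight to be [N]. *)
Lemma weight_string a b : roots a -> roots b -> ~ weight (b + a) ->
  exists N : nat, 2 * form b a = N%:R * form a a /\
    forall k, (k <= N)%N -> weight (b - a *+ k).
Proof.
move=> ra rb nab; have [e [f [ae af ef]]] := root_sl2 ra.
case: (rb) => b0 [x x0 bx].
pose fk k := iter k (lie f) x; pose m := b (coroot a) : F.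
have fkw k : in_root_space (b - a *+ k) (fk k).
  elim: k => [|k IH]; first by rewrite subr0.
  by rewrite /fk iterS mulrS opprD addrCA; apply: in_root_spaceD.
have step k : lie e (fk k.+1) = (k.+1%:R * (m - k%:R)) *: fk k.
  apply: (sl2_raise_lower _ ef).
  - rewrite af lfunE /= coroot_eval // -mulrA divff ?form_norm_neq0 ?mulr1 //.
  - exact: bx.
  - by apply: (root_space_eq0 nab); rewrite addrC; apply: in_root_spaceD.
have [k kE] : exists k, fk k == 0.
  have [k nk] := string_finite b (roots_opp ra).1; exists k.
  by apply/eqP; apply: (root_space_eq0 nk); rewrite mulNrn.
case: (ex_minnP (ex_intro (fun k => fk k == 0) k kE)) => {k kE} N1.
move=> fN0 minN; case: N1 fN0 minN => [|N].
  by move=> x00; case/negP: x0.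
move=> fN0 minN; have nz j : (j <= N)%N -> fk j != 0.
  by move=> jN; apply/negP => /minN; rewrite ltnNge jN.
exists N; split; last first.
  by move=> k kN; apply: root_space_weight (fkw k) (nz k kN).
have := step N; rewrite (eqP fN0) linear0 => /esym/eqP.
rewrite scaler_eq0 (negPf (nz N _)) // orbF mulf_eq0 pnatr_eq0 /= subr_eq0 => /eqP mN.
by rewrite -mN /m coroot_eval // divfK ?form_norm_neq0.
Qed.

Lemma form_addMn a b c k : form (b + a *+ k) c = form b c + k%:R * form a c.
Proof.
rewrite form_addl; congr (_ + _); elim: k => [|k IH].
  by rewrite mulr0n mul0r /Defs.form /sharp linear0 /= (killingC Qu) linear0.
by rewrite mulrS form_addl IH mulrS mulrDl mul1r.
Qed.

(** Climb from [b] to the top of its [a]-string, where [weight_string] applies. *)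
Lemma cartan_integer a b : roots a -> roots b ->
  exists z : int, 2 * form b a = z%:~R * form a a.
Proof.
move=> ra rb; have [k kE] : exists k, ~~ `[< weight (b + a *+ k) >].
  by have [k nk] := string_finite b ra.1; exists k; apply/asboolP.
case: (ex_minnP (ex_intro (fun k => ~~ `[< weight (b + a *+ k) >]) k kE)) => {k kE} k1.
move=> nk mink; case: k1 nk mink => [|k].
  by rewrite mulr0n addr0 => /asboolP; case; have /rootsE[] := rb.
move=> /asboolP nk mink; have wk : weight (b + a *+ k).
  by apply/asboolP; apply/negPn/negP => /mink; rewrite ltnn.
have [bk|bk] := eqVneq (b + a *+ k) 0.
  exists (- k%:Z * 2); rewrite intrM rmorphN /= -pmulrn.
  have -> : form b a = - k%:R * form a a; last by ring.
  have := form_addMn a b a k; rewrite bk /Defs.form /sharp linear0 (killingC Qu) linear0.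
  by move/eqP; rewrite eq_sym addr_eq0 => /eqP ->; rewrite mulNr.
have rbk : roots (b + a *+ k) by apply/rootsE.
have [|N [NE _]] := weight_string ra rbk; first by rewrite -addrA -mulrSr.
exists (N%:Z - k%:Z * 2); rewrite intrB intrM -!pmulrn mulrBl -NE form_addMn; ring.
Qed.

(** With [z i] the Cartan number of [w i] and [a], the expression of the Killing
    form by weights reads [(a, a) = (a, a)^2 * \sum_i (z i / 2)^2]. *)
Lemma form_norm_gt0 a : roots a -> 0 < form a a.
Proof.
move=> ra; have aa0 := form_norm_neq0 ra.
have /choice[z zE] i : exists z : int, w i (sharp a) = z%:~R / 2 * form a a.
  have [->|wi] := eqVneq (w i) 0; first by exists 0; rewrite lfunE !mul0r.
  have rwi : roots (w i) by apply/rootsE; split=> //; exists i.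
  have [z zE] := cartan_integer ra rwi; exists z; rewrite -(form_eval a rwi).
  by rewrite mulrAC -zE mulrC mulKf // pnatr_eq0.
have : form a a = form a a ^+ 2 * \sum_i ((z i)%:~R / 2) ^+ 2.
  rewrite {1}/Defs.form (killing_wt Qu Qd) mulr_sumr; apply: eq_bigr => i _.
  by rewrite zE; ring.
rewrite expr2 -mulrA -{1}[form a a]mulr1 => /(mulfI aa0) aE.
rewrite lt0r aa0 /= -invr_ge0.
have -> : (form a a)^-1 = \sum_i ((z i)%:~R / 2) ^+ 2.
  by apply: (mulfI aa0); rewrite mulfV.
apply: sumr_ge0 => i _; rewrite real_exprn_even_ge0 //.
by rewrite realM ?realV ?realn ?realz.
Qed.

Lemma form_roots_real a b : roots a -> roots b -> form a b \is Num.real.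
Proof.
move=> ra rb; have [z zE] := cartan_integer rb ra.
rewrite -(mulKf (_ : 2 != 0 :> F) (form a b)) ?pnatr_eq0 // zE.
by rewrite !realM ?realV ?realn ?realz // gtr0_real // form_norm_gt0.
Qed.

Lemma roots_finite : finite_set roots.
Proof.
apply: (@sub_finite_set _ _ (range w)); last exact: finite_image.
by move=> a /rootsE[_ [i <-]]; exists i.
Qed.

Lemma roots_nonempty : roots !=set0.
Proof.
apply/set0P/negP => /eqP r0; case: (simple_nonabelian simple_g) => x y.
have tT z : z \in t.
  apply: root_space0 => h; rewrite [z](wrowE Qu) linear_sum lfunE scale0r big1 // => i _.
  rewrite linearZ /= (wvec_in_root_space Qu Qd).
  have [->|wi] := eqVneq (w i) 0; first by rewrite lfunE scale0r scaler0.
  by have : roots (w i) by [apply/rootsE; split=> //; exists i]; rewrite r0.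
by case: cartan_t => abt _ _; rewrite abt.
Qed.

(** For a splitting of the roots into orthogonal parts [A] and [B], no [a + b] with
    [a] in [A] and [b] in [B] is a root or zero, and so the centralizer of the root
    spaces of [B] is an ideal. It contains the root spaces of [A]. *)
Lemma simple_roots_irreducible : irreducible_roots roots.
Proof.
split=> [|A B AB AB0 orthAB]; first exact: roots_nonempty.
have rA a : A a -> roots a by rewrite -AB; left.
have rB b : B b -> roots b by rewrite -AB; right.
have sum_nw a b : A a -> B b -> ~ weight (a + b).
  move=> Aa Bb wab; have ab0 := orthAB _ _ Aa Bb.
  have aa := form_norm_neq0 (rA _ Aa); have bb := form_norm_neq0 (rB _ Bb).
  have [/eqP|s0] := eqVneq (a + b) 0.
    rewrite addr_eq0 => /eqP aE; move: ab0; rewrite [in form a b]aE form_oppl.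
    by move/eqP; rewrite oppr_eq0 (negPf bb).
  have : roots (a + b) by apply/rootsE.
  rewrite -AB => -[/orthAB-/(_ _ Bb)|/(orthAB _ _ Aa)].
    by rewrite form_addl ab0 add0r => /eqP; rewrite (negPf bb).
  by rewrite form_sym form_addl (form_sym b) ab0 addr0 => /eqP; rewrite (negPf aa).
have brAB i j : A (w i) -> B (w j) -> lie (v j) (v i) = 0.
  move=> Ai Bj; apply: (root_space_eq0 (sum_nw _ _ Ai Bj)); rewrite addrC.
  by apply: in_root_spaceD; apply: wvec_in_root_space.
have [|C0|CT] := @simple_dichotomy _ _ simple_g g _ (fun i => B (w i)) (fun i => ad (v i)).
- move=> x y yC i Bi; rewrite adE [x](wrowE Qu) (lie_suml _ _ _ y) linear_sum big1 // => j _.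
  rewrite lieZl linearZ /=.
  have yCi k : B (w k) -> lie (v k) y = 0 by move=> /yC; rewrite adE.
  have [wj|wj] := eqVneq (w j) 0.
    have vt : v j \in t by apply: root_space0; rewrite -wj; apply: wvec_in_root_space.
    have := wvec_in_root_space Qu Qd i (vsproj t (v j)); rewrite vsprojK // => vji.
    rewrite lie_derivation (lieC (v i) (v j)) vji lieNl lieZl yCi //.
    by rewrite !(linear0, scaler0, oppr0, addr0).
  have : roots (w j) by apply/rootsE; split=> //; exists j.
  rewrite -AB => -[Aj|Bj]; last by rewrite [lie (v j) y]yCi // linear0 scaler0.
  by rewrite lie_derivation brAB // lie0l yCi // linear0 addr0 scaler0.
- left; apply/seteqP; split=> // a Aa; have /rootsE[_ [i wi]] := rA _ Aa.
  case/eqP: (wvec_neq0 Qu i); apply: C0 => j Bj.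
  by rewrite adE brAB // wi.
right; apply/seteqP; split=> // b Bb; have /rootsE[_ [i wi]] := rB _ Bb.
case/eqP: (wvec_neq0 Qu i); apply: (simple_center simple_g) => y.
by rewrite -adE CT // wi.
Qed.

End RootSpaces.

(** * Combinatorics of positive roots *)

Lemma finite_maximal (T : eqType) (A : set T) (r : T -> T -> Prop) :
  finite_set A -> A !=set0 ->
  (forall x, ~ r x x) -> (forall x y z, r x y -> r y z -> r x z) ->
  exists2 m, A m & forall x, A x -> ~ r m x.
Proof.
move=> /finite_seqP[s ->{A}] [x0 /= x0s] irr tr.
elim: s x0 x0s => // x s IH _ _; case: s IH => [_|y s /(_ y)].
  by exists x => [|z]; rewrite /= inE // => /eqP ->; apply: irr.
rewrite inE eqxx => /(_ isT)[m ms mmax]; have [rmx|rmx] := pselect (r m x).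
  exists x => [|z]; rewrite /= inE ?eqxx // => /orP[/eqP ->|zs rxz]; first exact: irr.
  exact: mmax zs (tr _ _ _ rmx rxz).
exists m => [|z]; first by rewrite /= inE ms orbT.
by rewrite /= inE => /orP[/eqP ->//|]; apply: mmax.
Qed.

Section Combinatorics.
Variables (F : numFieldType) (g : lieAlgType F) (t : {vspace g}).
Local Notation V := (dual t).
Local Notation roots := (@Defs.roots _ _ t).
Local Notation form := (@Defs.form _ _ t).

(** What the sequel needs to know about the roots. By [geom_string], the [a]-string
    through [b] that begins at [b] goes at least as far as the reflection of [b]. *)
Record root_geometry : Prop := RootGeometry {
  geom_finite : finite_set roots;
  geom_neq0 : forall a, roots a -> a != 0;
  geom_rootsN : forall a, roots a -> roots (- a);
  geom_formC : forall a b, form a b = form b a;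
  geom_formDl : forall a b c, form (a + b) c = form a c + form b c;
  geom_form_real : forall a b, roots a -> roots b -> form a b \is Num.real;
  geom_form_gt0 : forall a, roots a -> 0 < form a a;
  geom_coroot : forall a b, roots b -> b (coroot a) = 2 * form b a / form a a;
  geom_string : forall a b, roots a -> roots b -> ~ (b + a = 0 \/ roots (b + a)) ->
    exists N : nat, 2 * form b a = N%:R * form a a /\
      forall k, (k <= N)%N -> b - a *+ k = 0 \/ roots (b - a *+ k)
}.

Hypothesis geom : root_geometry.
Implicit Types (a b c x y : V) (Phi Psi S : set V) (s : seq V).

Local Notation finite_roots := (geom_finite geom).
Local Notation root_neq0 := (geom_neq0 geom).
Local Notation rootsN := (geom_rootsN geom).
Local Notation formC := (geom_formC geom).
Local Notation formDl := (geom_formDl geom).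
Local Notation form_real := (geom_form_real geom).
Local Notation form_gt0 := (geom_form_gt0 geom).
Local Notation root_string := (geom_string geom).

Lemma formDr a b c : form c (a + b) = form c a + form c b.
Proof. by rewrite formC formDl !(formC c). Qed.

Lemma form0l a : form 0 a = 0.
Proof. by apply: (addIr (form 0 a)); rewrite -formDl !add0r. Qed.

Lemma formNl a b : form (- a) b = - form a b.
Proof. by apply/eqP; rewrite -addr_eq0 -formDl addNr form0l. Qed.

Lemma formNr a b : form a (- b) = - form a b.
Proof. by rewrite formC formNl formC. Qed.

Lemma formBl a b c : form (a - b) c = form a c - form b c.
Proof. by rewrite formDl formNl. Qed.

Lemma form_suml s a : form (\sum_(b <- s) b) a = \sum_(b <- s) form b a.
Proof.
elim: s => [|b s IH]; first by rewrite !big_nil form0l.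
by rewrite !big_cons formDl IH.
Qed.

Lemma form_neq0 a : roots a -> form a a != 0.
Proof. by move=> /form_gt0/gt_eqF ->. Qed.

(** If [a + b] is neither zero nor a root, then [a] begins its [b]-string, which
    makes the Cartan number a natural number. *)
Lemma root_sum a b : roots a -> roots b -> form a b < 0 -> a + b = 0 \/ roots (a + b).
Proof.
move=> ra rb ab; apply: contrapT => nab.
have [N [NE _]] := root_string rb ra nab.
have : 2 * form a b < 0 by rewrite pmulr_rlt0 // ltr0n.
by rewrite NE le_gtF // mulr_ge0 // ltW ?form_gt0.
Qed.

Lemma root_diff a b : roots a -> roots b -> 0 < form a b -> a = b \/ roots (a - b).
Proof.
move=> ra rb ab; case: (@root_sum a (- b)) => //; first exact: rootsN.
- by rewrite formNr oppr_lt0.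
- by move=> /eqP; rewrite subr_eq0 => /eqP; left.
- by right.
Qed.

Variable P : set V.
Hypothesis pos_P : positive_system P.

Lemma pos_root a : P a -> roots a. Proof. by case: pos_P => + _ _ _; apply. Qed.

Lemma pos_total a : roots a -> P a \/ P (- a). Proof. by case: pos_P => _ + _ _; apply. Qed.

Lemma pos_anti a : P a -> ~ P (- a). Proof. by case: pos_P => _ _ + _; apply. Qed.

Lemma pos_addr a b : P a -> P b -> roots (a + b) -> P (a + b).
Proof. by case: pos_P => _ _ _; apply. Qed.

Lemma pos_sum_neq0 a b : P a -> P b -> a + b <> 0.
Proof. by move=> Pa Pb /eqP; rewrite addr_eq0 => /eqP aE; apply: (pos_anti Pb); rewrite -aE. Qed.

Lemma pos_neqN a : P a -> a <> - a.
Proof. by move=> Pa aE; apply: (pos_anti Pa); rewrite -aE. Qed.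

Lemma sum_form_neg s a : (forall b, b \in s -> roots b) -> roots a ->
  form (\sum_(b <- s) b) a < 0 -> exists2 b, b \in s & form b a < 0.
Proof.
move=> rs ra; rewrite form_suml => neg; apply: contrapT => nob.
move: neg; rewrite le_gtF // big_seq sumr_ge0 // => b bs.
rewrite real_leNgt ?real0 //; last exact: form_real (rs _ bs) ra.
apply/negP => ba; apply: nob.
by exists b.
Qed.

Lemma sum_form_pos s a : (forall b, b \in s -> roots b) -> roots a ->
  0 < form (\sum_(b <- s) b) a -> exists2 b, b \in s & 0 < form b a.
Proof.
move=> rs ra; rewrite -oppr_lt0 -formNr => /(sum_form_neg rs (rootsN ra))[b bs].
by rewrite formNr oppr_lt0; exists b.
Qed.

(** The sums of elements of [S], given as sequences with repetitions, which suits
    induction better than coefficient functions. *)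
Definition cone S x := exists2 s, (forall a, a \in s -> S a) & x = \sum_(a <- s) a.

Lemma cone0 S : cone S 0.
Proof. by exists [::] => //; rewrite big_nil. Qed.

Lemma cone1 S a : S a -> cone S a.
Proof. by move=> Sa; exists [:: a]; rewrite ?big_seq1 // => b; rewrite inE => /eqP ->. Qed.

Lemma coneD S x y : cone S x -> cone S y -> cone S (x + y).
Proof.
move=> [s sS ->] [s' s'S ->]; exists (s ++ s'); last by rewrite big_cat.
by move=> a; rewrite mem_cat => /orP[/sS|/s'S].
Qed.

Lemma cone_rem S a s : (forall b, b \in s -> S b) -> a \in s ->
  cone S (\sum_(b <- s) b - a).
Proof.
move=> sS sa; exists (rem a s); first by move=> b /mem_rem/sS.
by rewrite (big_rem a) //= addrAC subrr add0r.
Qed.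

(** The cone of positive roots is pointed. In a sum [a + ...] that vanishes, some
    term has negative product with [a]; its sum with [a] is a positive root,
    whence a shorter sum that vanishes. *)
Lemma pos_sum_nil s : (forall a, a \in s -> P a) -> \sum_(a <- s) a = 0 -> s = [::].
Proof.
have [m] := ubnP (size s); elim: m s => // m IH [|a s] // sz sP; rewrite big_cons => s0.
have Pa : P a by apply: sP; rewrite inE eqxx.
have s'P b : b \in s -> P b by move=> bs; apply: sP; rewrite inE bs orbT.
have [b bs ba] : exists2 b, b \in s & form b a < 0.
  apply: sum_form_neg; [by move=> b /s'P/pos_root|exact: pos_root|].
  move/eqP: s0; rewrite addrC addr_eq0 => /eqP ->.
  by rewrite formNl oppr_lt0 form_gt0 //; apply: pos_root.
have Pb := s'P b bs.
have Pba : P (b + a).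
  case: (root_sum (pos_root Pb) (pos_root Pa) ba) => [/(pos_sum_neq0 Pb Pa)//|].
  exact: pos_addr.
have : (b + a) :: rem b s = [::].
  apply: IH.
  - have s_gt0 : (0 < size s)%N by case: (s) bs.
    by rewrite /= size_rem // prednK.
  - by move=> c; rewrite inE => /orP[/eqP ->//|/mem_rem/s'P].
  - by rewrite big_cons -[RHS]s0 [in RHS](big_rem b) //= addrA [b + a]addrC.
by [].
Qed.

Lemma cone_anti S x y : S `<=` P -> cone S (x - y) -> cone S (y - x) -> x = y.
Proof.
move=> SP [s sS xy] [s' s'S yx].
have : s ++ s' = [::].
  apply: pos_sum_nil; first by move=> a; rewrite mem_cat => /orP[/sS|/s'S]; apply: SP.
  by rewrite big_cat /= -xy -yx addrC subrKA subrr.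
move/(congr1 size); rewrite size_cat /= => /eqP; rewrite addn_eq0 size_eq0 => /andP[/eqP s0 _].
by apply/eqP; rewrite -subr_eq0 xy s0 big_nil.
Qed.

(** The sets met in the construction of the cascade: intersections of the roots
    with subspaces, and unions of components of such sets. *)
Record subsystem Phi : Prop := Subsystem {
  sub_roots : Phi `<=` roots;
  sub_opp : forall a, Phi a -> Phi (- a);
  sub_closed : forall a b, Phi a -> Phi b -> roots (a + b) -> Phi (a + b)
}.

Lemma sub_diff Phi a b : subsystem Phi -> Phi a -> Phi b -> roots (a - b) -> Phi (a - b).
Proof. by move=> sub fa fb; apply: sub_closed => //; apply: sub_opp. Qed.

Lemma sub_finite Phi : subsystem Phi -> finite_set Phi.
Proof. by move=> /sub_roots sub; apply: sub_finite_set sub finite_roots. Qed.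

(** The condition of [highest_root], with [cone] in place of coefficients. *)
Definition top Phi b := Phi b /\ forall c, Phi c -> cone (Phi `&` P) (b - c).

Section Highest.
Variable Phi : set V.
Hypothesis sub : subsystem Phi.
Local Notation Pos := (Phi `&` P).
Local Notation "a <=~ b" := (cone Pos (b - a)) (at level 70).

Lemma pos_le_root a : Pos a -> roots a.
Proof. by case=> /(sub_roots sub). Qed.

Lemma coneP_sub : Pos `<=` P. Proof. by move=> a []. Qed.

Lemma le_refl a : a <=~ a. Proof. by rewrite subrr; apply: cone0. Qed.

Lemma le_trans b a c : a <=~ b -> b <=~ c -> a <=~ c.
Proof. by move=> ab bc; rewrite -(subrKA b); apply: coneD. Qed.

Lemma le_anti a b : a <=~ b -> b <=~ a -> a = b.
Proof. by move=> ab ba; apply: cone_anti ba ab; apply: coneP_sub. Qed.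

Lemma le_addr a b : Pos b -> a <=~ a + b.
Proof. by move=> Pb; rewrite addrC addKr; apply: cone1. Qed.

Lemma Pos_sum a b : Pos a -> Pos b -> form a b < 0 -> Pos (a + b).
Proof.
move=> [fa Pa] [fb Pb] ab.
have [/(pos_sum_neq0 Pa Pb)//|rab] := root_sum (pos_root Pa) (pos_root Pb) ab.
by split; [apply: sub_closed|apply: pos_addr].
Qed.

Lemma Pos_total a : Phi a -> Pos a \/ Pos (- a).
Proof.
move=> fa; case: (pos_total (sub_roots sub fa)) => Pa; [left|right] => //.
by split=> //; apply: sub_opp.
Qed.

Lemma Pos_diff a b : Phi a -> Phi b -> 0 < form a b ->
  [\/ a = b, Pos (a - b) | Pos (b - a)].
Proof.
move=> fa fb ab; have ra := sub_roots sub fa; have rb := sub_roots sub fb.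
case: (root_diff ra rb ab) => [->|rab]; first by constructor 1.
by case: (Pos_total (sub_diff sub fa fb rab)); rewrite ?opprB => ?;
   [constructor 2|constructor 3].
Qed.

Definition maximal m := Phi m /\ forall x, Phi x -> m <=~ x -> x = m.

Lemma exists_maximal S : S `<=` Phi -> S !=set0 ->
  exists2 m, S m & forall x, S x -> m <=~ x -> x = m.
Proof.
move=> SPhi S0; have fS : finite_set S by apply: sub_finite_set SPhi (sub_finite sub).
have [||m Sm mmax] := @finite_maximal _ S (fun x y => x <> y /\ x <=~ y) fS S0.
- by move=> x [].
- move=> x y z [xy xley] [yz ylez]; split; last exact: le_trans ylez.
  by move=> xz; apply: xy; apply: le_anti => //; rewrite xz.
exists m => // x Sx mx; apply: contrapT => xm; apply: (mmax x Sx).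
by split=> // /esym.
Qed.

Lemma exists_minimal S : S `<=` Phi -> S !=set0 ->
  exists2 m, S m & forall x, S x -> x <=~ m -> x = m.
Proof.
move=> SPhi S0; have fS : finite_set S by apply: sub_finite_set SPhi (sub_finite sub).
have [||m Sm mmax] := @finite_maximal _ S (fun x y => x <> y /\ y <=~ x) fS S0.
- by move=> x [].
- move=> x y z [xy xley] [yz ylez]; split; last exact: le_trans xley.
  by move=> xz; apply: xy; apply: le_anti => //; rewrite xz.
exists m => // x Sx mx; apply: contrapT => xm; apply: (mmax x Sx).
by split=> // /esym.
Qed.

Lemma maximal_above c : Phi c -> exists2 m, maximal m & c <=~ m.
Proof.
move=> fc; have [||m [fm cm] mmax] := @exists_maximal [set x | Phi x /\ c <=~ x].
- by move=> x [].
- by exists c; split=> //; apply: le_refl.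
by exists m => //; split=> // x fx mx; apply: mmax => //; split=> //; apply: le_trans mx.
Qed.

Lemma maximal_pos m : maximal m -> Pos m.
Proof.
move=> [fm mmax]; case: (Pos_total fm) => // Pm; case: (pos_neqN Pm.2).
rewrite opprK; apply: mmax; first by case: Pm.
by apply: coneD; apply: cone1.
Qed.

(** Otherwise [m + a] would be a root above [m]. *)
Lemma maximal_dominant m a : maximal m -> Pos a -> 0 <= form m a.
Proof.
move=> mm Pa; have Pm := maximal_pos mm; have [_ mmax] := mm.
rewrite real_leNgt ?real0 //; last by apply: form_real; apply: pos_le_root.
apply/negP => /(Pos_sum Pm Pa)[fma _]; have /eqP := mmax _ fma (le_addr _ Pa).
rewrite -subr_eq0 addrC addKr => /eqP a0.
by have := root_neq0 (pos_le_root Pa); rewrite a0 eqxx.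
Qed.

(** The product is nonnegative by dominance; were it positive, [m - m'] would be a
    root and the two would be comparable. *)
Lemma maximal_orthogonal m m' : maximal m -> maximal m' -> m <> m' -> form m m' = 0.
Proof.
move=> mm mm' neq; have Pm := maximal_pos mm; have Pm' := maximal_pos mm'.
apply/eqP; rewrite eq_le maximal_dominant // andbT real_leNgt ?real0 //; last first.
  by apply: form_real; apply: pos_le_root.
apply/negP => /(Pos_diff Pm.1 Pm'.1)[//|le|le]; apply: neq.
  by apply: (mm'.2 _ mm.1); apply: cone1.
by apply/esym/(mm.2 _ mm'.1); apply: cone1.
Qed.

(** [0 = (m, m')] is the sum of [(x, m')] and of products that are nonnegative by
    dominance. *)
Lemma below_orthogonal m m' x : maximal m -> maximal m' -> m <> m' ->
  Pos x -> x <=~ m -> form x m' = 0.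
Proof.
move=> mm mm' neq Px [s sP xm]; have dom a : Pos a -> 0 <= form a m'.
  by move=> Pa; rewrite formC maximal_dominant.
have s0 : 0 <= form (\sum_(a <- s) a) m'.
  by rewrite form_suml big_seq sumr_ge0 // => a /sP/dom.
apply/eqP; rewrite eq_le dom // andbT -oppr_ge0.
have := maximal_orthogonal mm mm' neq; rewrite -(subrK x m) xm formDl => /eqP.
by rewrite addr_eq0 => /eqP <-.
Qed.

(** Take a maximal common lower bound [c]. It is orthogonal to [m], so [m - c] has a
    term [a] with [(a, c) < 0], for which [c + a] is a root below [m]; choose such
    an [a] minimal. As [c] and [c + a] are orthogonal to [m'], so is [a], hence
    [m' - c] has a term [b] with [(b, a) > 0]. If [b - a] is zero or positive, then
    [c + a <= c + b <= m'] contradicts the maximality of [c]. If [a - b] is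
    positive, either [(b, c) < 0], and [c + b] contradicts the maximality of [c],
    or [a - b] contradicts the minimality of [a]. *)
Lemma no_common_lower_bound m m' x : maximal m -> maximal m' -> Pos x ->
  x <=~ m -> x <=~ m' -> m = m'.
Proof.
move=> mm mm' Px xm xm'; apply: contrapT => neq.
have [||c [Pc cm cm'] cmax] := @exists_maximal [set y | [/\ Pos y, y <=~ m & y <=~ m']].
- by move=> y [[]].
- by exists x.
have c_up a : Pos a -> Pos (c + a) -> c + a <=~ m -> c + a <=~ m' -> False.
  move=> Pa Pca cam cam'; have /eqP : c + a = c by apply: cmax => //; apply: le_addr.
  rewrite -subr_eq0 addrC addKr => /eqP a0.
  by have := root_neq0 (pos_le_root Pa); rewrite a0 eqxx.
have c_below s y : (forall a, a \in s -> Pos a) -> y - c = \sum_(a <- s) a ->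
    forall a, a \in s -> c + a <=~ y.
  by move=> sP ycE a sa; rewrite opprD addrA ycE; apply: cone_rem.
have neq' : m' <> m by move/esym.
have cm0 : form m c = 0 by rewrite formC; apply: below_orthogonal mm' mm neq' Pc cm'.
have [||a [Pa ac cam] amin] :=
    @exists_minimal [set a | [/\ Pos a, form a c < 0 & c + a <=~ m]].
- by move=> y [[]].
- case: (cm) => s sP mcE; have [a sa ac] : exists2 a, a \in s & form a c < 0.
    apply: sum_form_neg => [a /sP/pos_le_root//|| ]; first exact: pos_le_root.
    by rewrite -mcE formBl cm0 sub0r oppr_lt0 form_gt0 //; apply: pos_le_root.
  by exists a; split=> //; [apply: sP|apply: c_below mcE _ sa].
have Pca : Pos (c + a) by apply: Pos_sum => //; rewrite formC.
have am' : form a m' = 0.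
  have := below_orthogonal mm mm' neq Pca cam.
  by rewrite formDl (below_orthogonal mm mm' neq Pc cm) add0r.
case: (cm') => s sP mcE; have [b sb ba] : exists2 b, b \in s & 0 < form b a.
  apply: sum_form_pos => [b /sP/pos_le_root//|| ]; first exact: pos_le_root.
  by rewrite -mcE formBl formC am' sub0r formC oppr_gt0.
have Pb := sP b sb; have cbm' := c_below _ _ sP mcE b sb.
case: (Pos_diff Pb.1 Pa.1 ba) => [bE|Pba|Pab].
- by apply: (c_up a) => //; rewrite -bE.
- apply: (c_up a) => //; apply: le_trans cbm'.
  by rewrite opprD addrACA subrr add0r; apply: cone1.
have [bc|bc] := boolP (form b c < 0).
  apply: (c_up b) => //; first by apply: Pos_sum => //; rewrite formC.
  by apply: le_trans cam; rewrite opprD addrACA subrr add0r; apply: cone1.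
have rb := pos_le_root Pb; have rc := pos_le_root Pc.
have bc0 : 0 <= form b c by rewrite real_leNgt ?real0 //; apply: form_real.
have /eqP : a - b = a.
  apply: amin; last by rewrite opprB addrC subrK; apply: cone1.
  split=> //; first by rewrite formBl subr_lt0 (lt_le_trans ac).
  have -> : m - (c + (a - b)) = (m - (c + a)) + b.
    by rewrite !opprD opprK !addrA.
  by apply: coneD cam _; apply: cone1.
rewrite -subr_eq0 addrC addKr oppr_eq0 => /eqP b0.
by have := root_neq0 rb; rewrite b0 eqxx.
Qed.

(** The positive roots below a maximal root [m] are orthogonal to the other
    positive roots: if [a] is below [m] and [b] is not, then both [a + b] and
    [a - b] are excluded by [no_common_lower_bound]. So the set [A] of the roots
    that are below [m] up to sign is orthogonal to its complement. *)
Lemma irreducible_has_top : irreducible_roots Phi -> exists b, top Phi b.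
Proof.
case=> -[c0 fc0] irr; have [m mm _] := maximal_above fc0.
pose below c := Pos c /\ c <=~ m; exists m; split; first by case: mm.
pose A := [set c | below c \/ below (- c)].
have APhi : A `<=` Phi by move=> c [[[]]//|[[fc _] _]]; rewrite -[c]opprK; apply: sub_opp.
have below_closed a b : below a -> Pos b -> ~ below b -> form a b = 0.
  move=> [Pa am] Pb nb; have [m' mm' bm'] := maximal_above Pb.1.
  have mE m'' : maximal m'' -> a <=~ m'' -> m'' = m.
    by move=> mm'' am''; apply: (no_common_lower_bound mm'' mm Pa).
  have ra := pos_le_root Pa; have rb := pos_le_root Pb.
  apply/eqP; rewrite eq_le !real_leNgt ?real0 ?form_real //.
  apply/andP; split; apply/negP => ab.
    case: (Pos_diff Pa.1 Pb.1 ab) => [abE|Pab|Pba]; apply: nb.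
    - by rewrite -abE.
    - by split=> //; apply: le_trans am; apply: cone1.
    - by split=> //; rewrite -(mE m') //; apply: le_trans bm'; apply: cone1.
  have Pab := Pos_sum Pa Pb ab; have [m'' mm'' abm] := maximal_above Pab.1.
  apply: nb; split=> //; rewrite -(mE m'') //.
    by apply: le_trans abm; rewrite (addrC a); apply: le_addr.
  by apply: le_trans abm; apply: le_addr.
have [|||A0|B0] := irr A (Phi `\` A).
- by rewrite setUIr setUCr setIT; apply/setUidPr.
- by apply/seteqP; split=> // x [Ax [_ nAx]].
- move=> a b Aa [fb nAb]; have nb : ~ below b by move=> ?; apply: nAb; left.
  have nNb : ~ below (- b) by move=> ?; apply: nAb; right.
  case: Aa => Aa; case: (Pos_total fb) => Pb.
  - exact: below_closed.
  - by rewrite -[b]opprK formNr below_closed ?oppr0.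
  - by rewrite -[a]opprK formNl below_closed ?oppr0.
  - by rewrite -[a]opprK -[b]opprK formNl formNr below_closed ?oppr0.
- have : A m by left; split; [apply: maximal_pos|apply: le_refl].
  by rewrite A0.
move=> c fc; have : A c by apply: contrapT => nAc; have : (Phi `\` A) c by []; rewrite B0.
case=> -[Pc cm] //; apply: le_trans cm.
by apply: coneD; apply: cone1.
Qed.

Section TopRoot.
Variable th : V.
Hypothesis top_th : top Phi th.

Lemma top_maximal : maximal th.
Proof. by case: top_th => fth thmax; split=> // x fx; apply: le_anti; apply: thmax. Qed.

Lemma top_pos : Pos th. Proof. exact/maximal_pos/top_maximal. Qed.

Lemma top_unique b : top Phi b -> b = th.
Proof.
by case=> fb bmax; case: top_th => fth thmax; apply: le_anti; [apply: thmax|apply: bmax].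
Qed.

(** A positive root not orthogonal to [th] begins its [th]-string, which it
    descends by [N] steps. The second step would lead to [th - (c - th)], a root
    above [th], or to zero. *)
Lemma top_half c : Pos c -> c <> th -> form c th != 0 ->
  2 * form c th = form th th /\ Pos (th - c).
Proof.
move=> Pc cth cth0; have Pth := top_pos; have [fth thmax] := top_th.
have rth := pos_le_root Pth; have rc := pos_le_root Pc.
have [|N [NE strN]] := root_string rth rc.
  case=> [/(pos_sum_neq0 Pc.2 Pth.2)//|rcth].
  have fcth := sub_closed sub Pc.1 fth rcth.
  have /eqP : c + th = th.
    by apply: top_maximal.2 => //; rewrite [c + th]addrC; apply: le_addr.
  by rewrite -subr_eq0 addrK => /eqP c0; have := root_neq0 rc; rewrite c0 eqxx.
have N0 : N != 0%N.
  by apply: contra_neq cth0 => N0; move/eqP: NE; rewrite N0 mul0r mulf_eq0 pnatr_eq0 => /eqP.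
have th_le x : Phi x -> th <=~ x -> x = th by apply: top_maximal.2.
have rcth : roots (c - th).
  have := strN 1%N; rewrite lt0n N0 => /(_ isT)[/eqP|//].
  by rewrite subr_eq0 => /eqP.
have fcth := sub_diff sub Pc.1 fth rcth.
have Pthc : Pos (th - c).
  case: (Pos_total fcth) => [le|]; last by rewrite opprB.
  by case: cth; apply: th_le Pc.1 _; apply: cone1.
split=> //; rewrite NE; suff -> : N = 1%N by rewrite mul1r.
apply/eqP; rewrite eqn_leq lt0n N0 andbT leqNgt; apply/negP => N2.
have := strN 2%N N2; rewrite mulr2n opprD addrA => -[|rcth2].
  move/eqP; rewrite subr_eq0 => /eqP cthE; case: cth; apply: th_le Pc.1 _.
  by rewrite cthE; apply: cone1.
have := sub_opp sub (sub_diff sub fcth fth rcth2); rewrite opprB => fx.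
have /eqP : th - (c - th) = th.
  by apply: th_le fx _; rewrite addrC addKr opprB; apply: cone1.
by rewrite -subr_eq0 addrC addKr opprB subr_eq0 => /eqP /esym.
Qed.

End TopRoot.
End Highest.

(** * The cascade *)

Lemma fsum_cone Phi x : finite_set Phi ->
  cone (Phi `&` P) x <-> exists n : V -> nat, x = \sum_(a \in Phi `&` P) a *+ n a.
Proof.
move=> fPhi; have fS : finite_set (Phi `&` P) by apply: finite_setIl.
split=> [[s sS ->]|[n ->]].
  exists (fun a => count_mem a s); rewrite fsbig_finite //=.
  elim: s sS => [|a s IH] sS; first by rewrite big_nil big1 // => ? _; rewrite mulr0n.
  have aS : a \in fset_set (Phi `&` P).
    by rewrite in_fset_set // inE; apply: sS; rewrite inE eqxx.
  rewrite big_cons IH; last by move=> b bs; apply: sS; rewrite inE bs orbT.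
  under [RHS]eq_bigr do rewrite /= mulrnDr.
  rewrite big_split /=; congr (_ + _).
  rewrite (bigD1_seq a) ?fset_uniq //= eqxx mulr1n big1 ?addr0 // => b /negPf ba.
  by rewrite eq_sym ba.
rewrite fsbig_finite //= big_seq; apply: (big_ind (cone (Phi `&` P))).
- exact: cone0.
- by move=> a b; apply: coneD.
move=> a; rewrite in_fset_set // inE => Sa.
elim: (n a) => [|k IH]; first by rewrite mulr0n; apply: cone0.
by rewrite mulrS; apply: coneD => //; apply: cone1.
Qed.

Lemma highest_rootE Phi b : subsystem Phi -> highest_root P Phi b <-> top Phi b.
Proof.
move=> /sub_finite fPhi; split=> -[fb bmax]; split=> // c /bmax.
  by move/(fsum_cone _ fPhi).
by move/(fsum_cone _ fPhi).
Qed.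

Lemma roots_subsystem : subsystem roots.
Proof. by split=> // a; apply: rootsN. Qed.

Lemma orthogonal_subsystem Phi b : subsystem Phi -> subsystem (orthogonal_roots Phi b).
Proof.
move=> [sr so sc]; split.
- by move=> a [/sr].
- by move=> a [fa ab]; split; [apply: so|rewrite formNl ab oppr0].
- by move=> a c [fa ab] [fc cb] rac; split; [apply: sc|rewrite formDl ab cb addr0].
Qed.

(** A root [a + b] is not orthogonal to both [a] and [b], since its norm is not
    zero, and so cannot leave their component. *)
Lemma component_subsystem Phi Psi : subsystem Phi -> irreducible_component Phi Psi ->
  subsystem Psi.
Proof.
move=> [sr so sc] [PsiPhi _ orth].
have key a b : Psi a -> Phi b -> form a b != 0 -> Psi b.
  move=> pa fb ab; apply: contrapT => nb; case/eqP: ab; exact: orth.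
split.
- by move=> a /PsiPhi/sr.
- move=> a pa; have fa := PsiPhi _ pa; apply: (key _ _ pa (so _ fa)).
  by rewrite formNr oppr_eq0 form_neq0 //; apply: sr.
move=> a b pa pb rab; have fab := sc _ _ (PsiPhi _ pa) (PsiPhi _ pb) rab.
have [ab0|ab0] := eqVneq (form (a + b) a) 0; last first.
  by apply: (key _ _ pa fab); rewrite formC.
apply: (key _ _ pb fab); rewrite formC; apply: contraNneq (form_neq0 rab) => bb0.
by rewrite formDr ab0 bb0 addr0.
Qed.

(** Were [c] outside [Psi], it would be orthogonal to [b]. Then [b - c] would not
    be orthogonal to [b], hence would be in [Psi], nor to [c], which is outside. *)
Lemma component_root Phi Psi b c : subsystem Phi -> irreducible_component Phi Psi ->
  Psi b -> Phi c -> roots (b - c) -> Psi c.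
Proof.
move=> sub [PsiPhi _ orth] pb fc rbc; apply: contrapT => nc.
have fb := PsiPhi _ pb; have fbc := sub_diff sub fb fc rbc.
have bc0 : form b c = 0 by apply: orth.
have rb := sub_roots sub fb; have rc := sub_roots sub fc.
have pbc : Psi (b - c).
  apply: contrapT => nbc; have := orth _ _ pb (conj fbc nbc).
  by rewrite formDr formNr bc0 subr0 => /eqP; rewrite (negPf (form_neq0 rb)).
have := orth _ _ pbc (conj fc nc); rewrite formBl bc0 sub0r => /eqP.
by rewrite oppr_eq0 (negPf (form_neq0 rc)).
Qed.

Lemma component_subset Phi Psi Psi' c : irreducible_component Phi Psi ->
  irreducible_component Phi Psi' -> Psi c -> Psi' c -> Psi `<=` Psi'.
Proof.
move=> [PsiPhi [_ irr] _] [_ _ orth'] pc p'c.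
have [|||I0|D0] := irr (Psi `&` Psi') (Psi `\` Psi').
- by rewrite setUIDK.
- by apply/seteqP; split=> // x [[_ ?] [_ ?]].
- by move=> a b [_ p'a] [pb nb]; apply: orth' => //; split=> //; apply: PsiPhi.
- by have : (Psi `&` Psi') c by []; rewrite I0.
move=> x px; apply: contrapT => nx; have : (Psi `\` Psi') x by [].
by rewrite D0.
Qed.

Lemma component_eq Phi Psi Psi' c : irreducible_component Phi Psi ->
  irreducible_component Phi Psi' -> Psi c -> Psi' c -> Psi = Psi'.
Proof.
move=> comp comp' pc p'c; apply/seteqP; split.
  exact: component_subset comp comp' pc p'c.
exact: component_subset comp' comp p'c pc.
Qed.

(** The component is the least set containing [c] that is closed, within [Phi],
    under passing to roots that are not orthogonal to one of its elements. *)
Lemma component_exists Phi c : Phi c -> exists2 Psi, irreducible_component Phi Psi & Psi c.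
Proof.
move=> fc; pose closed D := forall a b, D a -> Phi b -> form a b != 0 -> D b.
pose Psi := [set x | forall D : set V, D c -> closed D -> D x].
have Psi_closed : closed Psi.
  by move=> a b pa fb ab D Dc Dcl; apply: (Dcl a) => //; apply: pa.
have pc : Psi c by [].
exists Psi => //; split.
- by move=> x; apply => // a b.
- split; first by exists c.
  move=> A B AB AB0 orth.
  have side (A' B' : set V) : A' `|` B' = Psi -> A' `&` B' = set0 ->
      (forall a b, A' a -> B' b -> form a b = 0) -> A' c -> B' = set0.
    move=> AB' AB0' orth' A'c; apply/seteqP; split=> // x B'x.
    suff A'x : A' x by rewrite -AB0'.
    have : Psi x by rewrite -AB'; right.
    apply=> // a b A'a fb ab; have : Psi b.
      by apply: (Psi_closed a) => //; rewrite -AB'; left.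
    rewrite -AB' => -[//|B'b]; case/eqP: ab; exact: orth'.
  have : (A `|` B) c by rewrite AB.
  case=> [Ac|Bc]; [right; exact: (side A B)|left; apply: (side B A) => //].
  - by rewrite setUC.
  - by rewrite setIC.
  - by move=> a b Ba Ab; rewrite formC orth.
move=> a b pa [fb nb]; apply/eqP; apply: contra_notT nb => ab.
exact: Psi_closed pa fb ab.
Qed.

Local Notation cascade_from := (cascade_from P).

Lemma cascade_sub Phi b : cascade_from Phi b -> Phi b.
Proof.
elim=> [{}Phi {}b [] //|{}Phi b' Psi c _ [sub _ _] _ pc].
by have [] := sub _ pc.
Qed.

Lemma cascade_inv Phi th b : subsystem Phi -> top Phi th -> cascade_from Phi b ->
  b = th \/ exists Psi, [/\ irreducible_component (orthogonal_roots Phi th) Psi,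
                            cascade_from Psi b & form b th = 0].
Proof.
move=> + + casc; case: casc => {Phi b}[Phi b hb|Phi b' Psi c hb comp cc] sub topth.
  by left; apply: (top_unique topth); apply/(highest_rootE _ sub).
right; have bE : b' = th by apply: (top_unique topth); apply/(highest_rootE _ sub).
rewrite -bE; exists Psi; split=> //; have [PsiO _ _] := comp.
by have [] := PsiO _ (cascade_sub cc).
Qed.

(** Descend the tree until [b] and [c] separate: then one of them is the greatest
    root and the other orthogonal to it, or they are in different components. *)
Lemma cascade_orthogonal Phi b c : subsystem Phi -> cascade_from Phi b ->
  cascade_from Phi c -> b <> c -> form b c = 0.
Proof.
move=> sub casc; elim: casc sub c => {Phi b}[Phi b hb|Phi th Psi b hb comp cb IH] sub c cc bc.
  have /(highest_rootE _ sub) topb := hb.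
  case: (cascade_inv sub topb cc) => [cE|[Psi [_ _ cb]]]; first by case: bc.
  by rewrite formC.
have /(highest_rootE _ sub) topth := hb.
have subO := orthogonal_subsystem th sub; have subPsi := component_subsystem subO comp.
have [PsiO _ orth] := comp; have pb := cascade_sub cb.
case: (cascade_inv sub topth cc) => [cE|[Psi' [comp' c'c _]]].
  by rewrite cE; have [] := PsiO _ pb.
have [PsiO' _ _] := comp'; have p'c := cascade_sub c'c.
have [pc|nc] := pselect (Psi c); last by apply: orth => //; split=> //; apply: PsiO'.
apply: IH => //; have PsiE := component_eq comp comp' pc p'c.
by rewrite PsiE.
Qed.

(** Descend the tree along [b] and [b']. While both are in proper components, so is
    [c], and in the same one, by [component_root]. If just one of them is the
    greatest root [th], the other, [d], is orthogonal to [th]; then [(c, th) >= 0]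
    and [(d - c, th) >= 0] give [(c, th) = 0], and [th - c] violates [top_half]. *)
Lemma cascade_unique Phi b b' c : subsystem Phi -> cascade_from Phi b ->
  cascade_from Phi b' -> Phi c -> P c -> P (b - c) -> P (b' - c) -> b = b'.
Proof.
move=> sub casc casc'.
have top_case Psi th d : subsystem Psi -> top Psi th -> Psi d -> form d th = 0 ->
    Psi c -> P c -> P (th - c) -> P (d - c) -> False.
  move=> {}sub tth pd dth pc Pc Pthc Pdc; have Pth := top_pos sub tth.
  have Posc : (Psi `&` P) c by [].
  have Post x : Psi x -> P (x - c) -> (Psi `&` P) (x - c).
    by move=> px Px; split=> //; apply: sub_diff => //; apply: pos_root.
  have dom x : (Psi `&` P) x -> 0 <= form x th.
    by move=> Px; rewrite formC; apply: (maximal_dominant sub (top_maximal tth)).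
  have cth : form c th = 0.
    apply/eqP; rewrite eq_le dom // andbT -oppr_ge0.
    by have := dom _ (Post _ pd Pdc); rewrite formBl dth sub0r.
  have rth := pos_le_root sub Pth.
  have := top_half sub tth (Post _ tth.1 Pthc) _ _; rewrite formBl cth subr0.
  case; [|exact: form_neq0|].
    move/eqP; rewrite subr_eq -subr_eq0 opprD addrA subrr sub0r oppr_eq0.
    by rewrite (negPf (root_neq0 (pos_root Pc))).
  move=> /eqP; rewrite -subr_eq0 mulrDl mul1r addrK.
  by rewrite (negPf (form_neq0 rth)).
elim: casc sub b' casc' => {Phi b}[Phi b hb|Phi th Psi b hb comp cb IH] sub b' casc' fc Pc Pbc Pb'c.
  have /(highest_rootE _ sub) topb := hb.
  case: (cascade_inv sub topb casc') => [//|[Psi [comp _ b'b]]].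
  by case: (top_case Phi b b') => //; apply: cascade_sub.
have /(highest_rootE _ sub) topth := hb.
have subO := orthogonal_subsystem th sub; have subPsi := component_subsystem subO comp.
have [PsiO _ _] := comp; have pb := cascade_sub cb; have [fb bth] := PsiO _ pb.
case: (cascade_inv sub topth casc') => [b'E|[Psi' [comp' c'b' _]]].
  by case: (top_case Phi th b) => //; rewrite -b'E.
have rbc := pos_root Pbc; have rb'c := pos_root Pb'c; have pb' := cascade_sub c'b'.
have dom x : (Phi `&` P) x -> 0 <= form x th.
  by move=> Px; rewrite formC; apply: (maximal_dominant sub (top_maximal topth)).
have Oc : orthogonal_roots Phi th c.
  split=> //; apply/eqP; rewrite eq_le dom // andbT -oppr_ge0.
  have : (Phi `&` P) (b - c) by split=> //; apply: sub_diff.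
  by move/dom; rewrite formBl bth sub0r.
have pc := component_root subO comp pb Oc rbc.
have p'c := component_root subO comp' pb' Oc rb'c.
have PsiE := component_eq comp comp' pc p'c.
by apply: IH => //; rewrite PsiE.
Qed.

(** Each step of the descent loses the greatest root, whence an induction on the
    cardinal of [Phi]. *)
Lemma cascade_exists Phi c : subsystem Phi -> irreducible_roots Phi -> Phi c -> P c ->
  cascade_from Phi c \/
  exists b, [/\ cascade_from Phi b, 2 * form c b = form b b & P (b - c)].
Proof.
have [m] := ubnP #|` fset_set Phi|; elim: m Phi => // m IH Phi sz sub irr fc Pc.
have [th topth] := irreducible_has_top sub irr.
have hth : highest_root P Phi th by apply/(highest_rootE _ sub).
have [->|cth] := pselect (c = th); first by left; apply: cascade_top.
have [cth0|cth0] := eqVneq (form c th) 0; last first.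
  right; exists th; have [|half [_ Pthc]] := top_half sub topth _ cth cth0; first by [].
  by split=> //; apply: cascade_top.
have Oc : orthogonal_roots Phi th c by [].
have [Psi comp pc] := component_exists Oc.
have subPsi := component_subsystem (orthogonal_subsystem th sub) comp.
have [PsiO irrPsi _] := comp.
have szPsi : (#|` fset_set Psi| < #|` fset_set Phi|)%N.
  have fPhi := sub_finite sub; have fPsi := sub_finite subPsi.
  apply: fproper_ltn_card; rewrite fproperE; apply/andP; split.
    by apply/fsubsetP => x; rewrite !in_fset_set // !inE => /PsiO[].
  apply/fsubsetPn; exists th; rewrite in_fset_set // ?inE; first exact: topth.1.
  apply/negP; rewrite inE => /PsiO[_]; apply/eqP/form_neq0.
  exact: (sub_roots sub topth.1).
have [|cc|[b [cb half Pbc]]] := IH Psi _ subPsi irrPsi pc Pc.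
- exact: leq_trans szPsi _.
- by left; apply: cascade_next comp cc.
by right; exists b; split=> //; apply: cascade_next comp cb.
Qed.

Hypothesis irr_roots : irreducible_roots roots.
Local Notation K := (kostant_cascade P).

Lemma cascade_finite : finite_set K.
Proof. by apply: sub_finite_set finite_roots => b; apply: cascade_sub. Qed.

Lemma cascade_element_eval b : K b -> b (cascade_element P) = 1.
Proof.
move=> Kb; have rb := cascade_sub Kb; rewrite /cascade_element linearZ /=.
rewrite fsbig_finite /=; last exact: cascade_finite.
(* by orthogonality only the coroot of [b] contributes, with value 2 *)
have -> : b (\sum_(c <- fset_set K) coroot c) = \sum_(c <- fset_set K) b (coroot c).
  exact: linear_sum.
have bK : b \in fset_set K by rewrite in_fset_set ?inE //; apply: cascade_finite.
rewrite (bigD1_seq b) ?fset_uniq //=.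
have -> : \sum_(c <- fset_set K | c != b) b (coroot c) = 0.
  rewrite big_seq_cond; apply: big1 => c /andP[cK cb].
  move: cK; rewrite in_fset_set ?inE => [cK|]; last exact: cascade_finite.
  rewrite (geom_coroot geom) // (cascade_orthogonal roots_subsystem Kb cK) ?mulr0 ?mul0r //.
  by apply/eqP; rewrite eq_sym.
rewrite addr0 (geom_coroot geom) // mulfK ?form_neq0 //.
by rewrite /GRing.scale /= mulVf ?pnatr_eq0.
Qed.

(** [phi c] is [b - c] for the [b] of [cascade_exists]. The same [b] serves for
    [phi c], since [b - phi c = c] is positive, so [cascade_unique] makes [phi] an
    involution. *)
Lemma cascade_complement : exists phi : V -> V, forall c, (P `\` K) c ->
  [/\ K (c + phi c), (P `\` K) (phi c) & phi (phi c) = c].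
Proof.
have sub := roots_subsystem.
have /choice[phi phiP] c : exists d, (P `\` K) c -> K (c + d) /\ (P `\` K) d.
  have [[Pc nKc]|nc] := pselect ((P `\` K) c); last by exists 0.
  have [//|[b [Kb half Pbc]]] := cascade_exists sub irr_roots (pos_root Pc) Pc.
  have rb := cascade_sub Kb; have bb0 := form_neq0 rb.
  exists (b - c) => _; split; first by rewrite addrC subrK.
  split=> // Kbc; have [] := eqVneq (b - c) b.
    move/eqP; rewrite subr_eq -subr_eq0 opprD addrA subrr sub0r oppr_eq0.
    by rewrite (negPf (root_neq0 (pos_root Pc))).
  move=> /eqP/(cascade_orthogonal sub Kbc Kb); rewrite formBl => /eqP.
  rewrite subr_eq0 => /eqP bc; move: half; rewrite -bc => /eqP.
  by rewrite -subr_eq0 mulrDl mul1r addrK (negPf bb0).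
exists phi => c PKc; have [Kc PKd] := phiP c PKc; split=> //.
have [Kd PKe] := phiP _ PKd; have [Pc _] := PKc; have [Pd _] := PKd; have [Pe _] := PKe.
have := cascade_unique sub Kc Kd (pos_root Pd) Pd.
by rewrite addrK [X in X - _]addrC addrK => /(_ Pc Pe); rewrite addrC => /addrI.
Qed.

End Combinatorics.

Lemma simple_root_geometry (F : numFieldType) (g : lieAlgType F) (t : {vspace g}) Q :
  Q \in unitmx -> (forall h, h \in t -> is_diag_mx (ad_mx Q h)) ->
  cartan_subalgebra t -> lie_simple g -> root_geometry t.
Proof.
move=> Qu Qd cartan_t simple_g; split.
- exact: (roots_finite Qu Qd).
- by move=> a [].
- exact: (roots_opp Qu Qd).
- exact: (form_sym Qu).
- exact: (form_addl Qu).
- exact: (form_roots_real Qu Qd).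
- exact: (form_norm_gt0 Qu Qd).
- exact: (coroot_eval Qu Qd).
move=> a b ra rb nab; have wE (c : dual t) : weight Q c -> c = 0 \/ Defs.roots c.
  have [->|c0] := eqVneq c 0; first by left.
  by move=> wc; right; apply/(rootsE Qu Qd).
have [|N [NE wN]] := weight_string Qu Qd cartan_t simple_g ra rb.
  by move/wE.
by exists N; split=> // k /wN/wE.
Qed.

Lemma set_bij_card (T U : choiceType) (A : set T) (B : set U) (f : T -> U) :
  finite_set A -> set_bij A B f -> #|` fset_set A| = #|` fset_set B|.
Proof.
move=> fA [fAB finj fsurj]; have <- : f @` A = B.
  by apply/seteqP; split=> [_ [x Ax <-]|y /fsurj]; [apply: fAB|].
rewrite fset_set_image // card_in_imfset //= => x y.
rewrite !in_fset_set // !inE => Ax Ay; apply: finj; exact/mem_set.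
Qed.

Theorem lemma3p3 (R : realType) (g : lieAlgType R[i]) (t : {vspace g})
    (P : set (dual t)) :
  lie_simple g -> cartan_subalgebra t -> positive_system P ->
  (exists phi : dual t -> dual t,
     (forall c, (P `\` kostant_cascade P) c -> kostant_cascade P (c + phi c)) /\
     (forall d : R[i], set_bij (level_set P d) (level_set P (1 - d)) phi)) /\
  (forall d : R[i],
     finite_set (level_set P d) /\ level_mult P d = level_mult P (1 - d)).
Proof.
move=> simple_g cartan_t pos_P.
have [Q Qu Qd] := cartan_diagonal_basis cartan_t.
have geom : root_geometry t by apply: (simple_root_geometry Qu).
have irr := simple_roots_irreducible Qu Qd cartan_t simple_g.
have [phi phiP] := cascade_complement geom pos_P irr.
have level_bij d : set_bij (level_set P d) (level_set P (1 - d)) phi.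
  have phi_level d' c : level_set P d' c -> level_set P (1 - d') (phi c).
    move=> [PKc cd]; have [Kc PKd _] := phiP c PKc; split=> //.
    have := cascade_element_eval geom pos_P Kc; rewrite add_lfunE cd => <-.
    by rewrite addrC addKr.
  split=> [c|c c' /set_mem[PKc _] /set_mem[PKc' _] E|c dc]; first exact: phi_level.
    by have [_ _ <-] := phiP c PKc; have [_ _ <-] := phiP c' PKc'; rewrite E.
  exists (phi c); first by rewrite -[d](subKr 1); apply: phi_level.
  by have [_ _] := phiP c dc.1.
have level_finite d : finite_set (level_set P d).
  apply: sub_finite_set (geom_finite geom) => c [[Pc _] _].
  exact: pos_root pos_P _ Pc.
split; first by exists phi; split=> // c /phiP[].
by move=> d; split=> //; apply: set_bij_card (level_bij d).
Qed.
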